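(* Let $A$ be a commutative DG algebra with $H_*A$ a local Noetherian graded ring, and let $k$ be the residue field of $H_*A$. If $A$ is formal as an augmented DGA, then $A$ is homotopically regular if and only if it is algebraically regular.
   Context: $A$ is formal as an augmented DGA if there is a zig-zag of quasi-isomorphisms $A\simeq H_*A$ of DG algebras (with $H_*A$ given zero differential), compatible with the augmentations $A\to k$ and $H_*A\to k$. $A$ is homotopically regular if $k$ is a compact object of the derived category of DG $A$-modules. $A$ is algebraically regular if $H_*A$ is regular as a local graded ring, i.e. $k$ has finite projective dimension over $H_*A$. *)

(* Defs.v *)
From HB Require Import structures.
From Stdlib Require Export Relation_Operators.
From mathcomp Require Export all_boot all_order all_algebra.
From mathcomp Require Export boolp classical_sets.

Set Implicit Arguments.
Unset Strict Implicit.
Unset Printing Implicit Defensive.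

Import GRing.Theory.
Local Open Scope ring_scope.
Local Open Scope classical_set_scope.
Local Open Scope quotient_scope.

(* All graded objects are Z-graded, and internally so: a graded abelian group
   is the direct sum V of its components, given with the projections V -> V
   onto them. *)

Record grading (V : zmodType) := Grading {
  gpr :> int -> V -> V;
  gprB : forall n x y, gpr n (x - y) = gpr n x - gpr n y;
  gpr_pr : forall m n x, gpr m (gpr n x) = if m == n then gpr n x else 0;
  gpr_fin : forall x, exists2 s : seq int, uniq s & x = \sum_(n <- s) gpr n x }.

Definition homog (V : zmodType) (G : grading V) (n : int) (x : V) : Prop :=
  G n x = x.

Record gring := GradedRing {
  gring_ring :> pzRingType;
  grg : grading gring_ring;
  homog1 : homog grg 0 1;
  homogM : forall m n x y,
    homog grg m x -> homog grg n y -> homog grg (m + n) (x * y) }.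

Record gmod (R : gring) := GMod {
  gmod_mod :> lmodType R;
  gmg : grading gmod_mod;
  homogZ : forall m n (a : R) (x : gmod_mod),
    homog (grg R) m a -> homog gmg n x -> homog gmg (m + n) (a *: x) }.

Record gring_hom (R S : gring) := GRingHom {
  gring_fun :> {rmorphism R -> S};
  gring_fun_pr : forall n x, gring_fun (grg R n x) = grg S n (gring_fun x) }.

Record gmod_hom (R : gring) (M N : gmod R) := GModHom {
  gmod_fun :> {linear M -> N};
  gmod_fun_pr : forall n x, gmod_fun (gmg M n x) = gmg N n (gmod_fun x) }.

(* The Koszul sign (-1)^n. *)
Definition ksign (R : pzRingType) (n : int) : R := (-1) ^+ `|n|%N.

Definition graded_commutative (R : gring) : Prop :=
  forall m n (x y : R), homog (grg R) m x -> homog (grg R) n y ->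
    x * y = ksign R (m * n) * (y * x).

Definition graded_ideal (R : gring) (I : set R) : Prop :=
  [/\ I 0, (forall x y, I x -> I y -> I (x + y)),
      (forall a x, I x -> I (a * x) /\ I (x * a))
    & (forall n x, I x -> I (grg R n x))].

Definition graded_maximal (R : gring) (I : set R) : Prop :=
  [/\ graded_ideal I, ~ I 1
    & forall J : set R, graded_ideal J -> ~ J 1 -> I `<=` J -> J = I].

Definition graded_local (R : gring) : Prop :=
  exists! I : set R, graded_maximal I.

Definition graded_noetherian (R : gring) : Prop :=
  forall I : set R, graded_ideal I ->
    exists s : seq R,
      I = [set x | exists c : 'I_(size s) -> R, x = \sum_i c i * s`_i].

(* pi exhibits k as the residue field of the graded local ring R, which is a *)
(* graded field and need not be concentrated in degree 0.                    *)
Definition residue_map (R k : gring) (pi : gring_hom R k) : Prop :=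
  (forall y, exists x, pi x = y) /\ graded_maximal [set x | pi x = 0].

(* DG algebras are over Z and not assumed commutative, DG modules are left
   modules, and differentials have degree -1. *)

Record differential (V : zmodType) (G : grading V) := Differential {
  diff :> V -> V;
  diffB : forall x y, diff (x - y) = diff x - diff y;
  diffK : forall x, diff (diff x) = 0;
  diff_homog : forall n x, homog G n x -> homog G (n - 1) (diff x) }.

Record dga := DGA {
  dga_ring :> gring;
  dgad : differential (grg dga_ring);
  dga_leibniz : forall n x y, homog (grg dga_ring) n x ->
    dgad (x * y) = dgad x * y + ksign dga_ring n * (x * dgad y) }.

Record dgmod (A : dga) := DGMod {
  dgmod_mod :> gmod A;
  dgmd : differential (gmg dgmod_mod);
  dgmod_leibniz : forall n (a : A) (x : dgmod_mod), homog (grg A) n a ->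
    dgmd (a *: x) = dgad A a *: x + ksign A n *: (a *: dgmd x) }.

Record dga_hom (A B : dga) := DGAHom {
  dga_fun :> gring_hom A B;
  dga_fun_d : forall x, dga_fun (dgad A x) = dgad B (dga_fun x) }.

Record dgmod_hom (A : dga) (M N : dgmod A) := DGModHom {
  dgmod_fun :> gmod_hom M N;
  dgmod_fun_d : forall x, dgmod_fun (dgmd M x) = dgmd N (dgmod_fun x) }.

(* f induces an injection, resp. a surjection, ker d / im d -> ker d / im d. *)
Definition quasi_iso (V W : zmodType) (dV : V -> V) (dW : W -> W) (f : V -> W) :=
  (forall x, dV x = 0 -> (exists y, f x = dW y) -> exists y, x = dV y) /\
  (forall y, dW y = 0 -> exists x, dV x = 0 /\ exists z, y = f x + dW z).

Definition dga_quasi_iso (A B : dga) (f : dga_hom A B) :=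
  quasi_iso (dgad A) (dgad B) f.

Definition dgmod_quasi_iso (A : dga) (M N : dgmod A) (f : dgmod_hom M N) :=
  quasi_iso (dgmd M) (dgmd N) f.

Section GradingTheory.
Variables (V : zmodType) (G : grading V).

Lemma gpr0 n : G n 0 = 0.
Proof. by rewrite -[X in G n X](subrr 0) gprB subrr. Qed.

Lemma gprN n x : G n (- x) = - G n x.
Proof. by rewrite -[in LHS]sub0r gprB gpr0 sub0r. Qed.

Lemma gprD n x y : G n (x + y) = G n x + G n y.
Proof. by rewrite -[in LHS](opprK y) gprB gprN opprK. Qed.

Lemma gpr_sum n (I : Type) (r : seq I) (F : I -> V) :
  G n (\sum_(i <- r) F i) = \sum_(i <- r) G n (F i).
Proof. exact: (big_morph (G n) (gprD n) (gpr0 n)). Qed.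

Lemma homog_gpr n x : homog G n (G n x).
Proof. by rewrite /homog gpr_pr eqxx. Qed.

Lemma homog0 n : homog G n 0. Proof. exact: gpr0. Qed.

Lemma homog_prE m n x : homog G n x -> G m x = if m == n then x else 0.
Proof. by move=> hx; rewrite -hx gpr_pr. Qed.

Lemma gpr_eq0 x : exists s : seq int, forall n, n \notin s -> G n x = 0.
Proof.
have [s us xE] := gpr_fin G x; exists s => n ns.
rewrite xE gpr_sum big1_seq // => m /andP[_ ms].
by rewrite gpr_pr; case: eqP ns => // ->; rewrite ms.
Qed.

Lemma gpr_sumE (t : seq int) x : uniq t ->
  (forall n, n \notin t -> G n x = 0) -> x = \sum_(n <- t) G n x.
Proof.
move=> ut tx; have [s us xE] := gpr_fin G x.
have sx n : n \notin s -> G n x = 0.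
  move=> ns; rewrite xE gpr_sum big1_seq // => m /andP[_ ms].
  by rewrite gpr_pr; case: eqP ns => // ->; rewrite ms.
rewrite {1}xE (bigID (mem t)) /= [X in _ + X]big1 ?addr0; last by move=> n /tx.
rewrite [RHS](bigID (mem s)) /= [X in _ + X]big1 ?addr0; last by move=> n /sx.
rewrite -[LHS]big_filter -[RHS]big_filter; apply: perm_big.
by apply: uniq_perm; rewrite ?filter_uniq // => n; rewrite !mem_filter andbC.
Qed.

End GradingTheory.

Section DifferentialTheory.
Variables (V : zmodType) (G : grading V) (d : differential G).

Lemma diff0 : d 0 = 0. Proof. by rewrite -[X in d X](subrr 0) diffB subrr. Qed.

Lemma diffN x : d (- x) = - d x.
Proof. by rewrite -[in LHS]sub0r diffB diff0 sub0r. Qed.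

Lemma diffD x y : d (x + y) = d x + d y.
Proof. by rewrite -[in LHS](opprK y) diffB diffN opprK. Qed.

Lemma diff_sum (I : Type) (r : seq I) (F : I -> V) :
  d (\sum_(i <- r) F i) = \sum_(i <- r) d (F i).
Proof. exact: (big_morph d diffD diff0). Qed.

Lemma diff_pr n x : d (G n x) = G (n - 1) (d x).
Proof.
have [s us xE] := gpr_fin G x.
have dh m : homog G (m - 1) (d (G m x)) by apply/diff_homog/homog_gpr.
rewrite [in LHS]xE [in RHS]xE gpr_sum !diff_sum gpr_sum; apply: eq_bigr => m _.
rewrite gpr_pr (homog_prE _ (dh m)) (inj_eq (addIr _)).
by case: (n == m); rewrite ?diff0.
Qed.

End DifferentialTheory.

Lemma zero_diffB (V : zmodType) (x y : V) : 0 = 0 - 0 :> V.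
Proof. by rewrite subr0. Qed.

Definition zero_diff (V : zmodType) (G : grading V) : differential G :=
  @Differential V G (fun=> 0) (@zero_diffB V) (fun=> erefl)
    (fun n _ _ => homog0 G (n - 1)).

Lemma zero_diff_leibniz (R : gring) n (x y : R) : homog (grg R) n x ->
  zero_diff (grg R) (x * y) =
    zero_diff (grg R) x * y + ksign R n * (x * zero_diff (grg R) y).
Proof. by move=> _ /=; rewrite mul0r !mulr0 addr0. Qed.

Definition dga_of_gring (R : gring) : dga := DGA (@zero_diff_leibniz R).

Section DGATheory.
Variable A : dga.
Let G := grg A.
Let d := dgad A.

Lemma dga_d1 : d 1 = 0.
Proof.
have := @dga_leibniz A _ 1 1 (homog1 A).
rewrite -/d !mulr1 /ksign expr0 !mul1r => h.
by apply: (addrI (d 1)); rewrite addr0 -h.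
Qed.

Lemma dga_cycleM x y : d x = 0 -> d y = 0 -> d (x * y) = 0.
Proof.
move=> dx dy; have [s _ ->] := gpr_fin G x.
rewrite mulr_suml diff_sum big1 // => n _.
rewrite (dga_leibniz _ (homog_gpr G n x)) -/d dy diff_pr dx gpr0.
by rewrite mul0r !mulr0 addr0.
Qed.

Lemma dga_boundMl x y : d x = 0 -> exists z, x * d y = d z.
Proof.
move=> dx; have [s _ xE] := gpr_fin G x.
exists (\sum_(n <- s) G n x * (ksign A n * y)).
rewrite {1}xE mulr_suml diff_sum; apply: eq_bigr => n _.
rewrite (dga_leibniz _ (homog_gpr G n x)) -/d diff_pr dx gpr0 mul0r add0r.
rewrite /ksign -signr_odd; case: odd; last by rewrite expr0 !mul1r.
by rewrite expr1 !mulN1r diffN mulrN opprK.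
Qed.

Lemma dga_boundMr x y : d y = 0 -> exists z, d x * y = d z.
Proof.
move=> dy; have [s _ xE] := gpr_fin G x.
exists (\sum_(n <- s) G n x * y).
rewrite {1}xE diff_sum mulr_suml diff_sum; apply: eq_bigr => n _.
by rewrite (dga_leibniz _ (homog_gpr G n x)) -/d dy !mulr0 addr0.
Qed.

Definition cycle_pred : {pred A} := fun x => d x == 0.

Lemma cycle_subring : subring_closed cycle_pred.
Proof.
split=> [|x y /eqP dx /eqP dy|x y /eqP dx /eqP dy]; apply/eqP.
- exact: dga_d1.
- by rewrite diffB dx dy subr0.
- exact: dga_cycleM.
Qed.
HB.instance Definition _ := GRing.isSubringClosed.Build A cycle_pred cycle_subring.

Definition cycles := {x : A | x \in cycle_pred}.
HB.instance Definition _ := SubType.on cycles.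
HB.instance Definition _ := Choice.on cycles.
HB.instance Definition _ := 
  GRing.SubChoice_isSubPzRing.Build A cycle_pred cycles (subringClosedP _).

Lemma cycleP (z : cycles) : d (\val z) = 0. Proof. exact/eqP/(valP z). Qed.

Lemma cval0 : \val (0 : cycles) = 0. Proof. exact: raddf0. Qed.

Lemma cvalB (z w : cycles) : \val (z - w) = \val z - \val w.
Proof. exact: raddfB. Qed.

Lemma cvalM (z w : cycles) : \val (z * w) = \val z * \val w.
Proof. exact: rmorphM. Qed.

Lemma cval_sum (I : Type) (r : seq I) (F : I -> cycles) :
  \val (\sum_(i <- r) F i) = \sum_(i <- r) \val (F i).
Proof. exact: raddf_sum. Qed.

Lemma cycle_mem x : d x = 0 -> x \in cycle_pred. Proof. by move/eqP. Qed.

Definition cycle x (dx : d x = 0) : cycles := Sub x (cycle_mem dx).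

Definition bound_pred : {pred cycles} := fun z => `[< exists y, \val z = d y >].

Lemma bound_closed : zmod_closed bound_pred.
Proof.
split=> [|x y /asboolP[u xE] /asboolP[v yE]]; apply/asboolP.
  by exists 0; rewrite cval0 diff0.
by exists (u - v); rewrite cvalB xE yE diffB.
Qed.
HB.instance Definition _ := GRing.isZmodClosed.Build cycles bound_pred bound_closed.

Definition homology := Quotient.quot bound_pred.
HB.instance Definition _ := GRing.Zmodule.on homology.

Definition hclass (z : cycles) : homology := \pi z.

Lemma hclassP z w : reflect (exists y, \val z - \val w = d y) (hclass z == hclass w).
Proof. by rewrite -Quotient.idealrBE -cvalB; apply: asboolP. Qed.

Lemma hclass_repr (a : homology) : hclass (repr a) = a. Proof. exact: reprK. Qed.

Lemma hclassB z w : hclass (z - w) = hclass z - hclass w.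
Proof. by rewrite /hclass raddfB. Qed.

Definition hone : homology := hclass 1.
Definition hmul (a b : homology) : homology := hclass (repr a * repr b).

Lemma hclassM z w : hmul (hclass z) (hclass w) = hclass (z * w).
Proof.
move: (hclass_repr (hclass z)) (hclass_repr (hclass w)); rewrite /hmul.
move: (repr (hclass z)) (repr (hclass w)) => z' w'.
move=> /eqP/hclassP[u uE] /eqP/hclassP[v vE].
have [x xE] := dga_boundMr u (cycleP w').
have [y yE] := dga_boundMl v (cycleP z).
apply/eqP/hclassP; exists (x + y); rewrite diffD -xE -yE -uE -vE !cvalM.
by rewrite mulrBl mulrBr addrA subrK.
Qed.

Lemma hmulA : associative hmul.
Proof.
move=> a b c; rewrite -(hclass_repr a) -(hclass_repr b) -(hclass_repr c).
by rewrite !hclassM mulrA.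
Qed.

Lemma hmul1l : left_id hone hmul.
Proof. by move=> a; rewrite -(hclass_repr a) hclassM mul1r. Qed.

Lemma hmul1r : right_id hone hmul.
Proof. by move=> a; rewrite -(hclass_repr a) hclassM mulr1. Qed.

Lemma hclassD z w : hclass (z + w) = hclass z + hclass w.
Proof. by rewrite /hclass raddfD. Qed.

Lemma hmulDl : left_distributive hmul +%R.
Proof.
move=> a b c; rewrite -(hclass_repr a) -(hclass_repr b) -(hclass_repr c).
by rewrite -hclassD !hclassM mulrDl hclassD.
Qed.

Lemma hmulDr : right_distributive hmul +%R.
Proof.
move=> a b c; rewrite -(hclass_repr a) -(hclass_repr b) -(hclass_repr c).
by rewrite -hclassD !hclassM mulrDr hclassD.
Qed.

HB.instance Definition _ := GRing.Zmodule_isPzRing.Build homology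
  hmulA hmul1l hmul1r hmulDl hmulDr.

Lemma cycle_pr_subproof n (z : cycles) : d (G n (\val z)) = 0.
Proof. by rewrite diff_pr cycleP gpr0. Qed.

Definition cycle_pr n (z : cycles) : cycles := cycle (cycle_pr_subproof n z).

Lemma cycle_prE n z : \val (cycle_pr n z) = G n (\val z). Proof. by []. Qed.

Definition hpr n (a : homology) : homology := hclass (cycle_pr n (repr a)).

Lemma hclass_pr n z : hpr n (hclass z) = hclass (cycle_pr n z).
Proof.
rewrite /hpr; move: (hclass_repr (hclass z)) => /eqP/hclassP[u uE].
apply/eqP/hclassP; exists (G (n + 1) u).
by rewrite diff_pr addrK -uE gprB.
Qed.

Lemma hprB n a b : hpr n (a - b) = hpr n a - hpr n b.
Proof.
rewrite -(hclass_repr a) -(hclass_repr b) -hclassB !hclass_pr -hclassB.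
by congr hclass; apply: val_inj; rewrite cvalB !cycle_prE cvalB gprB.
Qed.

Lemma hpr_pr m n a : hpr m (hpr n a) = if m == n then hpr n a else 0.
Proof.
rewrite -(hclass_repr a) !hclass_pr.
have -> : cycle_pr m (cycle_pr n (repr a)) =
    if m == n then cycle_pr n (repr a) else 0.
  by apply: val_inj => /=; rewrite gpr_pr; case: (m == n).
by case: (m == n); rewrite // /hclass raddf0.
Qed.

Lemma hpr_fin a :
  exists2 s : seq int, uniq s & a = \sum_(n <- s) hpr n a.
Proof.
have [s us aE] := gpr_fin G (\val (repr a)); exists s => //.
rewrite -[LHS]hclass_repr; under eq_bigr do rewrite /hpr.
rewrite -(big_morph hclass hclassD (raddf0 _)); congr hclass.
by apply: val_inj; rewrite cval_sum.
Qed.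

Definition hgrading : grading homology := Grading hprB hpr_pr hpr_fin.

Lemma homog_hclass n (z : cycles) : homog G n (\val z) -> homog hgrading n (hclass z).
Proof.
by move=> hz; rewrite /homog /= hclass_pr; congr hclass; apply: val_inj.
Qed.

Lemma homog_hrepr n (a : homology) : homog hgrading n a ->
  exists2 z : cycles, homog G n (\val z) & a = hclass z.
Proof.
by move=> <-; exists (cycle_pr n (repr a)); first exact: homog_gpr.
Qed.

Lemma hhomog1 : homog hgrading 0 1.
Proof. exact/homog_hclass/homog1. Qed.

Lemma hhomogM m n (a b : homology) : homog hgrading m a -> homog hgrading n b ->
  homog hgrading (m + n) (a * b).
Proof.
move=> /homog_hrepr[z hz ->] /homog_hrepr[w hw ->].
have -> : hclass z * hclass w = hclass (z * w) by exact: hclassM.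
exact/homog_hclass/homogM.
Qed.

Definition homology_gring : gring := GradedRing hhomog1 hhomogM.

End DGATheory.

Definition restr (R S : gring) (f : gring_hom R S) : Type := S.

Section Restriction.
Variables (R S : gring) (f : gring_hom R S).

HB.instance Definition _ := GRing.Zmodule.on (restr f).

Definition restr_scale (a : R) (x : restr f) : restr f := f a * (x : S).

Lemma restr_scaleA a b x :
  restr_scale a (restr_scale b x) = restr_scale (a * b) x.
Proof. by rewrite /restr_scale rmorphM mulrA. Qed.

Lemma restr_scale1 : left_id 1 restr_scale.
Proof. by move=> x; rewrite /restr_scale rmorph1 mul1r. Qed.

Lemma restr_scaleDr : right_distributive restr_scale +%R.
Proof. by move=> a x y; apply: mulrDr. Qed.

Lemma restr_scaleDl x : {morph restr_scale^~ x : a b / a + b}.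
Proof. by move=> a b; rewrite /restr_scale rmorphD mulrDl. Qed.

HB.instance Definition _ := GRing.Zmodule_isLmodule.Build R (restr f)
  restr_scaleA restr_scale1 restr_scaleDr restr_scaleDl.

Definition restr_grading : grading (restr f) := grg S.

Lemma gring_fun_homog n a : homog (grg R) n a -> homog (grg S) n (f a).
Proof. by rewrite /homog -gring_fun_pr => ->. Qed.

Lemma restr_homogZ m n (a : R) (x : restr f) : homog (grg R) m a ->
  homog restr_grading n x -> homog restr_grading (m + n) (a *: x).
Proof. by move=> /gring_fun_homog ha hx; apply: (@homogM S). Qed.

Definition gmod_of_hom : gmod R := GMod restr_homogZ.

End Restriction.

Section DGRestriction.
Variables (A B : dga) (f : dga_hom A B).

Definition restr_diff : differential (gmg (gmod_of_hom f)) := dgad B.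

Lemma restr_leibniz n (a : A) (x : gmod_of_hom f) : homog (grg A) n a ->
  restr_diff (a *: x) =
    dgad A a *: x + ksign A n *: (a *: restr_diff x).
Proof.
move=> /(gring_fun_homog f) ha.
rewrite [LHS](dga_leibniz _ ha) -dga_fun_d; congr (_ + _).
by rewrite /GRing.scale /= /restr_scale /ksign rmorphXn rmorphN1.
Qed.

Definition dgmod_of_hom : dgmod A := DGMod restr_leibniz.

End DGRestriction.

Section DirectSum.
Variables (A : dga) (I : choiceType) (M : I -> dgmod A).

Definition dprod : Type := forall i, M i.
HB.instance Definition _ := gen_eqMixin dprod.
HB.instance Definition _ := gen_choiceMixin dprod.

Definition dprod_zero : dprod := fun i => 0.
Definition dprod_opp (x : dprod) : dprod := fun i => - x i.
Definition dprod_add (x y : dprod) : dprod := fun i => x i + y i.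
Definition dprod_scale (a : A) (x : dprod) : dprod := fun i => a *: x i.

Lemma dprod_addA : associative dprod_add.
Proof. by move=> x y z; apply: functional_extensionality_dep => i; apply: addrA. Qed.
Lemma dprod_addC : commutative dprod_add.
Proof. by move=> x y; apply: functional_extensionality_dep => i; apply: addrC. Qed.
Lemma dprod_add0 : left_id dprod_zero dprod_add.
Proof. by move=> x; apply: functional_extensionality_dep => i; apply: add0r. Qed.
Lemma dprod_addN : left_inverse dprod_zero dprod_opp dprod_add.
Proof. by move=> x; apply: functional_extensionality_dep => i; apply: addNr. Qed.
HB.instance Definition _ := GRing.isZmodule.Build dprod
  dprod_addA dprod_addC dprod_add0 dprod_addN.

Lemma dprod_scaleA a b x :
  dprod_scale a (dprod_scale b x) = dprod_scale (a * b) x.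
Proof. by apply: functional_extensionality_dep => i; apply: scalerA. Qed.
Lemma dprod_scale1 : left_id 1 dprod_scale.
Proof. by move=> x; apply: functional_extensionality_dep => i; apply: scale1r. Qed.
Lemma dprod_scaleDr : right_distributive dprod_scale +%R.
Proof. by move=> a x y; apply: functional_extensionality_dep => i; apply: scalerDr. Qed.
Lemma dprod_scaleDl x : {morph dprod_scale^~ x : a b / a + b}.
Proof. by move=> a b; apply: functional_extensionality_dep => i; apply: scalerDl. Qed.
HB.instance Definition _ := GRing.Zmodule_isLmodule.Build A dprod
  dprod_scaleA dprod_scale1 dprod_scaleDr dprod_scaleDl.

Definition finsupp_on (s : seq I) (x : dprod) := forall i, i \notin s -> x i = 0.

Definition finsupp_pred : {pred dprod} :=
  fun x => `[< exists s : seq I, finsupp_on s x >].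

Lemma finsupp_closed : submod_closed finsupp_pred.
Proof.
split=> [|a x y /asboolP[s sx] /asboolP[t ty]]; apply/asboolP.
  by exists [::].
exists (s ++ t) => i; rewrite mem_cat negb_or => /andP[/sx xi /ty yi].
have -> : (a *: x + y) i = a *: x i + y i by [].
by rewrite xi yi scaler0 addr0.
Qed.
HB.instance Definition _ :=
  GRing.isSubmodClosed.Build A dprod finsupp_pred finsupp_closed.

Definition dsum_carrier := {x : dprod | x \in finsupp_pred}.
HB.instance Definition _ := SubType.on dsum_carrier.
HB.instance Definition _ := Choice.on dsum_carrier.
HB.instance Definition _ := [SubChoice_isSubLmodule of dsum_carrier by <:].

Definition dval (x : dsum_carrier) : dprod := \val x.

Lemma dsum_ext (x y : dsum_carrier) : (forall i, dval x i = dval y i) -> x = y.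
Proof. by move=> xy; apply/val_inj/functional_extensionality_dep. Qed.

Lemma dval_fin (x : dsum_carrier) :
  exists2 s : seq I, uniq s & finsupp_on s (dval x).
Proof.
have /asboolP[s sx] := valP x; exists (undup s); rewrite ?undup_uniq // => i.
by rewrite mem_undup; apply: sx.
Qed.

Lemma dval0 i : dval 0 i = 0. Proof. by []. Qed.
Lemma dvalD x y i : dval (x + y) i = dval x i + dval y i. Proof. by []. Qed.
Lemma dvalB x y i : dval (x - y) i = dval x i - dval y i. Proof. by []. Qed.
Lemma dvalZ (a : A) x i : dval (a *: x) i = a *: dval x i. Proof. by []. Qed.
Lemma dval_sum (J : Type) (r : seq J) (F : J -> dsum_carrier) i :
  dval (\sum_(j <- r) F j) i = \sum_(j <- r) dval (F j) i.
Proof.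
exact: (big_morph (fun x => dval x i) (fun x y => dvalD x y i) (dval0 i)).
Qed.

Lemma dsum_map_subproof (f : forall i, M i -> M i) (f0 : forall i, f i 0 = 0)
    (x : dsum_carrier) : (fun i => f i (dval x i)) \in finsupp_pred.
Proof.
by apply/asboolP; have [s _ sx] := dval_fin x; exists s => i /sx ->; apply: f0.
Qed.

Definition dsum_map f f0 x : dsum_carrier := 
  exist (fun y : dprod => y \in finsupp_pred) _ (@dsum_map_subproof f f0 x).

Definition dsum_pr (n : int) : dsum_carrier -> dsum_carrier :=
  @dsum_map (fun i => gmg (M i) n) (fun i => gpr0 (gmg (M i)) n).

Definition dsum_d : dsum_carrier -> dsum_carrier :=
  @dsum_map (fun i => dgmd (M i)) (fun i => diff0 (dgmd (M i))).

Lemma dsum_prB n x y : dsum_pr n (x - y) = dsum_pr n x - dsum_pr n y.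
Proof. by apply: dsum_ext => i; apply: gprB. Qed.

Lemma dsum_pr_pr m n x :
  dsum_pr m (dsum_pr n x) = if m == n then dsum_pr n x else 0.
Proof.
by apply: dsum_ext => i; rewrite [LHS]gpr_pr; case: (m == n).
Qed.

Lemma dsum_pr_fin x :
  exists2 s : seq int, uniq s & x = \sum_(n <- s) dsum_pr n x.
Proof.
have [s _ sx] := dval_fin x.
pose S i := sval (cid (gpr_eq0 (gmg (M i)) (dval x i))).
have SP i n : n \notin S i -> gmg (M i) n (dval x i) = 0.
  exact: (svalP (cid (gpr_eq0 (gmg (M i)) (dval x i)))).
pose t := undup (flatten [seq S i | i <- s]).
exists t; first exact: undup_uniq.
apply: dsum_ext => i; rewrite dval_sum.
apply: (gpr_sumE (G := gmg (M i))); first exact: undup_uniq.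
move=> n; rewrite mem_undup => nt.
have [si|/sx ->] := boolP (i \in s); last exact: gpr0.
by apply: SP; apply: contra nt => nS; apply/flatten_mapP; exists i.
Qed.

Definition dsum_grading := Grading dsum_prB dsum_pr_pr dsum_pr_fin.

Lemma dsum_homogP n x :
  homog dsum_grading n x <-> forall i, homog (gmg (M i)) n (dval x i).
Proof.
split=> [hx i|hx]; last by apply: dsum_ext => i; apply: hx.
by rewrite /homog -[in RHS]hx.
Qed.

Lemma dsum_homogZ m n (a : A) (x : dsum_carrier) : homog (grg A) m a ->
  homog dsum_grading n x -> homog dsum_grading (m + n) (a *: x).
Proof. by move=> ha /dsum_homogP hx; apply/dsum_homogP => i; apply: homogZ. Qed.

Definition dsum_gmod : gmod A := GMod dsum_homogZ.

Lemma dsum_dB x y : dsum_d (x - y) = dsum_d x - dsum_d y.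
Proof. by apply: dsum_ext => i; apply: diffB. Qed.

Lemma dsum_dK x : dsum_d (dsum_d x) = 0.
Proof. by apply: dsum_ext => i; apply: diffK. Qed.

Lemma dsum_d_homog n x :
  homog dsum_grading n x -> homog dsum_grading (n - 1) (dsum_d x).
Proof. by move=> /dsum_homogP hx; apply/dsum_homogP => i; apply: diff_homog. Qed.

Definition dsum_diff : differential (gmg dsum_gmod) :=
  Differential dsum_dB dsum_dK dsum_d_homog.

Lemma dsum_leibniz n (a : A) (x : dsum_gmod) : homog (grg A) n a ->
  dsum_diff (a *: x) = dgad A a *: x + ksign A n *: (a *: dsum_diff x).
Proof. by move=> ha; apply: dsum_ext => i; apply: dgmod_leibniz. Qed.

Definition dsum : dgmod A := DGMod dsum_leibniz.

Lemma dsum_in_subproof i (x : M i) :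
  (dfwith (fun j => 0 : M j) x : dprod) \in finsupp_pred.
Proof.
apply/asboolP; exists [:: i] => j; rewrite inE => ji.
by rewrite dfwith_out // eq_sym.
Qed.

Definition dsum_in i (x : M i) : dsum := 
  exist (fun y : dprod => y \in finsupp_pred) _ (dsum_in_subproof x).

End DirectSum.

Lemma zero_diff_hom (R S : gring) (f : gring_hom R S) (x : R) :
  f (dgad (dga_of_gring R) x) = dgad (dga_of_gring S) (f x).
Proof. exact: rmorph0. Qed.

Definition dga_hom_of_gring (R S : gring) (f : gring_hom R S) :
    dga_hom (dga_of_gring R) (dga_of_gring S) :=
  @DGAHom (dga_of_gring R) (dga_of_gring S) f (zero_diff_hom f).

Record aug_dga (k : gring) := AugDGA {
  aug_alg : dga;
  aug_map : dga_hom aug_alg (dga_of_gring k) }.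

Definition aug_quasi_iso (k : gring) (B C : aug_dga k) : Prop :=
  exists f : dga_hom (aug_alg B) (aug_alg C),
    dga_quasi_iso f /\ forall x, aug_map C (f x) = aug_map B x.

(* A zig-zag of augmented quasi-isomorphisms, through DG algebras that need  *)
(* not be commutative.                                                       *)
Definition formal_augmented (A : dga) (k : gring)
    (eps : dga_hom A (dga_of_gring k)) (pi : gring_hom (homology_gring A) k) :=
  clos_refl_sym_trans (aug_dga k) (@aug_quasi_iso k)
    (AugDGA eps) (AugDGA (dga_hom_of_gring pi)).

(* The derived category of left DG A-modules: the localisation of the        *)
(* homotopy category at the quasi-isomorphisms, described by the calculus of *)
(* fractions. A morphism X -> Y is a class, for roof_eq, of roofs X <- Z -> Y *)
(* whose left leg is a quasi-isomorphism.                                    *)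

Section Derived.
Variable A : dga.

Definition homotopic (M N : dgmod A) (f g : M -> N) : Prop :=
  exists h : M -> N,
  [/\ (forall x y, h (x - y) = h x - h y),
      (forall n x, homog (gmg M) n x -> homog (gmg N) (n + 1) (h x)),
      (forall n (a : A) x, homog (grg A) n a ->
         h (a *: x) = ksign A n *: (a *: h x))
    & (forall x, f x - g x = dgmd N (h x) + h (dgmd M x))].

Record roof (X Y : dgmod A) := Roof {
  roof_apex : dgmod A;
  roof_den : dgmod_hom roof_apex X;
  roof_num : dgmod_hom roof_apex Y;
  roof_qis : dgmod_quasi_iso roof_den }.

Definition roof_eq (X Y : dgmod A) (r r' : roof X Y) : Prop :=
  exists (Z : dgmod A) (t : dgmod_hom Z X)
    (u : dgmod_hom Z (roof_apex r)) (u' : dgmod_hom Z (roof_apex r')),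
  [/\ dgmod_quasi_iso t,
      homotopic t (roof_den r \o u), homotopic t (roof_den r' \o u')
    & homotopic (roof_num r \o u) (roof_num r' \o u')].

Definition roof_null (X Y : dgmod A) (r : roof X Y) : Prop :=
  exists (Z : dgmod A) (t : dgmod_hom Z X) (u : dgmod_hom Z (roof_apex r)),
  [/\ dgmod_quasi_iso t, homotopic t (roof_den r \o u)
    & homotopic (roof_num r \o u) (fun=> 0)].

(* An element of the direct sum over i of Hom(X, M i), supported on s *)
Definition roof_family (X : dgmod A) (I : choiceType) (M : I -> dgmod A)
    (s : seq I) (phi : forall i, roof X (M i)) : Prop :=
  uniq s /\ forall i, i \notin s -> roof_null (phi i).

(* The canonical map from the direct sum of the Hom(X, M i) to               *)
(* Hom(X, dsum M), as a relation: Phi represents the sum over i in s of the  *)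
(* composites of phi i with the inclusions of the summands. As usual for     *)
(* fractions, the sum is computed after passage to a common denominator t.   *)
Definition roof_sum (X : dgmod A) (I : choiceType) (M : I -> dgmod A)
    (s : seq I) (phi : forall i, roof X (M i)) (Phi : roof X (dsum M)) : Prop :=
  exists (Z : dgmod A) (t : dgmod_hom Z X) (u : dgmod_hom Z (roof_apex Phi))
    (v : forall i, dgmod_hom Z (roof_apex (phi i))),
  [/\ dgmod_quasi_iso t, homotopic t (roof_den Phi \o u),
      (forall i, i \in s -> homotopic t (roof_den (phi i) \o v i))
    & homotopic (roof_num Phi \o u)
        (fun z => \sum_(i <- s) dsum_in (roof_num (phi i) (v i z)))].

(* X is compact when that map is onto and one-to-one for every family M. *)
Definition compact_object (X : dgmod A) : Prop :=
  forall (I : choiceType) (M : I -> dgmod A),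
    (forall Phi : roof X (dsum M),
       exists (s : seq I) (phi : forall i, roof X (M i)),
         roof_family s phi /\ roof_sum s phi Phi) /\
    (forall (Phi : roof X (dsum M)) (s s' : seq I)
       (phi phi' : forall i, roof X (M i)),
       roof_family s phi -> roof_family s' phi' ->
       roof_sum s phi Phi -> roof_sum s' phi' Phi ->
       forall i, roof_eq (phi i) (phi' i)).

End Derived.

Definition homotopically_regular (A : dga) (k : gring)
    (eps : dga_hom A (dga_of_gring k)) : Prop :=
  compact_object (dgmod_of_hom eps).

Definition gprojective (R : gring) (P : gmod R) : Prop :=
  forall (M N : gmod R) (p : gmod_hom M N) (g : gmod_hom P N),
    (forall y, exists x, p x = y) ->
    exists l : gmod_hom P M, forall x, p (l x) = g x.

Definition finite_projdim (R : gring) (M : gmod R) : Prop :=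
  exists (P : nat -> gmod R) (d : forall n, gmod_hom (P n.+1) (P n))
    (e : gmod_hom (P 0%N) M) (N : nat),
  [/\ (forall n, gprojective (P n)),
      (forall y, exists x, e x = y),
      (forall x, e x = 0 <-> exists y, x = d 0%N y),
      (forall n (x : P n.+1), d n x = 0 <-> exists y, x = d n.+1 y)
    & (forall n (x : P n), (N < n)%N -> x = 0)].

Definition algebraically_regular (A : dga) (k : gring)
    (pi : gring_hom (homology_gring A) k) : Prop :=
  finite_projdim (gmod_of_hom pi).

(* Main.v *)
(* A semi-free module T with basis e_0, e_1, ... is homotopically projective, *)
(* so if T resolves X, morphisms from X in the derived category are homotopy *)
(* classes of maps from T. Testing compactness on the map x |-> (x mod T_n)_n *)
(* from T to the sum of the quotients by the stages T_n = <e_0, ..., e_(n-1)> *)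
(* shows that X is compact iff the identity of T is homotopic to a map into  *)
(* some T_n; the converse holds because T_n is finitely generated. This      *)
(* criterion is transported by base change along a quasi-isomorphism of DG   *)
(* algebras. As the homology is Noetherian, k has such a resolution, the     *)
(* cycles of T_n to be killed being finitely generated over the homology.    *)
(* Formality thus reduces the theorem to H with zero differential. There T   *)
(* is the total complex of a projective resolution F of k, the layer F_n     *)
(* being spanned by the e_j of weight n. A homotopy into a finite stage      *)
(* makes the cycles of some F_N a summand, whence a finite resolution;       *)
(* conversely the total complex of a finite projective resolution of k maps  *)
(* to T inside a finite stage, and T is a homotopy retract of it.            *)

From HB Require Import structures.
From mathcomp Require Import zify.
Require Import Defs.

Set Implicit Arguments.
Unset Strict Implicit.
Unset Printing Implicit Defensive.

Import GRing.Theory.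
Local Open Scope ring_scope.
Local Open Scope classical_set_scope.

(** * Signs *)

Lemma ksignD (R : pzRingType) m n : ksign R (m + n) = ksign R m * ksign R n.
Proof.
rewrite /ksign -exprD -signr_odd -[in RHS]signr_odd; congr (_ ^+ _).
by rewrite oddD; lia.
Qed.

Lemma ksign1 (R : pzRingType) : ksign R 1 = -1.
Proof. by rewrite /ksign expr1. Qed.

Lemma ksignK (R : pzRingType) n : ksign R n * ksign R n = 1.
Proof. by rewrite /ksign -expr2 sqrr_sign. Qed.

Lemma ksignN (R : pzRingType) n : ksign R (- n) = ksign R n.
Proof. by rewrite /ksign abszN. Qed.

Lemma ksignC (R : pzRingType) n (a : R) : ksign R n * a = a * ksign R n.
Proof. by rewrite /ksign commr_sign. Qed.

Lemma ksign_case (R : pzRingType) n : {ksign R n = 1} + {ksign R n = -1}.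
Proof.
rewrite /ksign -signr_odd; case: odd; last by left; rewrite expr0.
by right; rewrite expr1.
Qed.

Section GradingInduction.
Variables (V : zmodType) (G : grading V).

Lemma gpr_ext x y : (forall n, G n x = G n y) -> x = y.
Proof.
move=> xy; apply/eqP; rewrite -subr_eq0; have [s _ ->] := gpr_fin G (x - y).
by rewrite big1 // => n _; rewrite gprB xy subrr.
Qed.

Lemma homog_ind (P : V -> Prop) : P 0 -> (forall x y, P x -> P y -> P (x + y)) ->
  (forall n x, homog G n x -> P x) -> forall x, P x.
Proof.
move=> P0 PD Ph x; have [s _ ->] := gpr_fin G x.
by apply: big_ind => // n _; apply: (Ph n); apply: homog_gpr.
Qed.

Lemma homogD n x y : homog G n x -> homog G n y -> homog G n (x + y).
Proof. by rewrite /homog gprD => -> ->. Qed.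

Lemma homogN n x : homog G n x -> homog G n (- x).
Proof. by rewrite /homog gprN => ->. Qed.

Lemma homogB n x y : homog G n x -> homog G n y -> homog G n (x - y).
Proof. by move=> hx hy; apply/homogD/homogN. Qed.

Lemma homog_sum n (I : Type) (r : seq I) (P : pred I) (F : I -> V) :
  (forall i, P i -> homog G n (F i)) -> homog G n (\sum_(i <- r | P i) F i).
Proof.
move=> h; apply: (big_ind (homog G n)) => //; first exact: homog0.
exact: homogD.
Qed.

End GradingInduction.

Section Sgn.
Variable R : gring.
Let G := grg R.

Definition sgn (a : R) : R :=
  \sum_(n <- s2val (cid2 (gpr_fin G a))) ksign R n * G n a.

Lemma gpr_ksign m n (a : R) : G m (ksign R n * a) = ksign R n * G m a.
Proof.
by case: (ksign_case R n) => ->; rewrite ?mul1r // !mulN1r gprN.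
Qed.

Lemma gpr_sgn m a : G m (sgn a) = ksign R m * G m a.
Proof.
rewrite /sgn gpr_sum [in RHS](s2valP' (cid2 (gpr_fin G a))) gpr_sum mulr_sumr.
apply: eq_bigr => n _; rewrite gpr_ksign gpr_pr.
by case: eqP => [->|_]; rewrite ?mulr0.
Qed.

Lemma sgnB a b : sgn (a - b) = sgn a - sgn b.
Proof. by apply: (gpr_ext (G := G)) => n; rewrite gprB !gpr_sgn gprB mulrBr. Qed.

Lemma sgn0 : sgn 0 = 0.
Proof. by rewrite -{1}(subrr 0) sgnB subrr. Qed.

Lemma sgnN a : sgn (- a) = - sgn a.
Proof. by rewrite -{1}(sub0r a) sgnB sgn0 sub0r. Qed.

Lemma sgnD a b : sgn (a + b) = sgn a + sgn b.
Proof. by rewrite -{1}(opprK b) sgnB sgnN opprK. Qed.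

Lemma sgnK : involutive sgn.
Proof.
by move=> a; apply: (gpr_ext (G := G)) => n; rewrite !gpr_sgn mulrA ksignK mul1r.
Qed.

Lemma sgn_homog n a : homog G n a -> sgn a = ksign R n * a.
Proof.
move=> ha; apply: (gpr_ext (G := G)) => m; rewrite gpr_sgn gpr_ksign.
by rewrite (homog_prE _ ha); case: eqP => [->|_]; rewrite ?mulr0.
Qed.

Lemma homog_sgn n a : homog G n a -> homog G n (sgn a).
Proof. by move=> ha; rewrite /homog gpr_sgn ha (sgn_homog ha). Qed.

Lemma sgnM a b : sgn (a * b) = sgn a * sgn b.
Proof.
elim/(homog_ind (G := G)): a => [|x y hx hy|m a ha].
- by rewrite mul0r !sgn0 mul0r.
- by rewrite mulrDl !sgnD hx hy mulrDl.
elim/(homog_ind (G := G)): b => [|x y hx hy|n b hb].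
- by rewrite mulr0 !sgn0 mulr0.
- by rewrite mulrDr !sgnD hx hy mulrDr.
rewrite (sgn_homog (homogM ha hb)) (sgn_homog ha) (sgn_homog hb) ksignD.
by rewrite !mulrA; congr (_ * _); rewrite -!mulrA; congr (_ * _); apply: ksignC.
Qed.

Lemma sgn1 : sgn 1 = 1.
Proof. by rewrite (sgn_homog (homog1 R)) mul1r. Qed.

End Sgn.

Lemma sgn_hom (R S : gring) (f : gring_hom R S) a : f (sgn a) = sgn (f a).
Proof.
apply: (gpr_ext (G := grg S)) => n; rewrite gpr_sgn -!gring_fun_pr gpr_sgn rmorphM.
by congr (_ * _); rewrite /ksign rmorphXn rmorphN1.
Qed.

Section DGSigns.
Variable A : dga.

Lemma sgn_diff (a : A) : sgn (dgad A a) = - dgad A (sgn a).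
Proof.
elim/(homog_ind (G := grg A)): a => [|x y hx hy|n a ha].
- by rewrite diff0 sgn0 diff0 oppr0.
- by rewrite diffD !sgnD hx hy diffD opprD.
rewrite (sgn_homog (diff_homog (dgad A) ha)) (sgn_homog ha) ksignD ksignN ksign1 mulrN1.
by case: (ksign_case A n) => ->; rewrite ?mulN1r ?opprK ?mul1r // diffN opprK.
Qed.

Lemma dga_leibniz_sgn (a b : A) : dgad A (a * b) = dgad A a * b + sgn a * dgad A b.
Proof.
elim/(homog_ind (G := grg A)): a => [|x y hx hy|n a ha].
- by rewrite mul0r diff0 sgn0 !mul0r addr0.
- by rewrite mulrDl !diffD sgnD hx hy !mulrDl addrACA.
by rewrite (dga_leibniz _ ha) (sgn_homog ha) mulrA.
Qed.

Lemma dgmod_leibniz_sgn (M : dgmod A) (a : A) (x : M) :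
  dgmd M (a *: x) = dgad A a *: x + sgn a *: dgmd M x.
Proof.
elim/(homog_ind (G := grg A)): a => [|u v hu hv|n a ha].
- by rewrite scale0r !diff0 sgn0 !scale0r addr0.
- by rewrite scalerDl !diffD sgnD hu hv !scalerDl addrACA.
by rewrite (dgmod_leibniz _ ha) (sgn_homog ha) scalerA.
Qed.

End DGSigns.

(* Dependent choice along nat, where the choice at [j] may depend on all the *)
(* previous ones.                                                            *)
Lemma seq_choice (W : Type) (w0 : W) (Q : nat -> (nat -> W) -> W -> Prop) :
  (forall j w w' v, (forall i, (i < j)%N -> w i = w' i) -> Q j w v -> Q j w' v) ->
  (forall j w, (forall i, (i < j)%N -> Q i w (w i)) -> exists v, Q j w v) ->
  exists w, forall j, Q j w (w j).
Proof.
move=> Qe Qs.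
pose next (l : seq W) := let w := nth w0 l in
  if pselect (exists v, Q (size l) w v) is left e then sval (cid e) else w0.
pose st := fix st n := if n is m.+1 then rcons (st m) (next (st m)) else [::].
have sst n : size (st n) = n by elim: n => //= n IH; rewrite size_rcons IH.
pose w n := next (st n).
have stE n i : (i < n)%N -> nth w0 (st n) i = w i.
  elim: n => // n IH; rewrite ltnS leq_eqVlt /= nth_rcons sst => /orP[/eqP->|lin].
    by rewrite ltnn eqxx.
  by rewrite lin IH.
exists w => j; elim/ltn_ind: j => j IH.
have ej : exists v, Q j (nth w0 (st j)) v.
  apply: Qs => i ij; rewrite (stE _ _ ij); apply: Qe (IH i ij) => l li.
  by rewrite stE // (ltn_trans li).
have : Q j (nth w0 (st j)) (w j).
  rewrite /w /next sst; case: pselect => // e; exact: (svalP (cid e)).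
by apply: Qe => i /stE.
Qed.

(** * The free module on a sequence *)

Section IdHom.
Variable A : dga.

Lemma gring_id_pr n (x : A) : idfun (grg A n x) = grg A n (idfun x).
Proof. by []. Qed.

Definition dga_id : dga_hom A A :=
  @DGAHom A A (@GRingHom A A (idfun : {rmorphism A -> A}) gring_id_pr)
    (fun=> erefl).

Definition dga_reg : dgmod A := dgmod_of_hom dga_id.

End IdHom.

Definition fsmod (A : dga) : lmodType A := @dsum_carrier A nat (fun=> dga_reg A).

Section FreeModule.
Variable A : dga.
Notation V := (fsmod A).

Definition coef (x : V) (i : nat) : A := dval x i.

Lemma coef0 i : coef 0 i = 0. Proof. by []. Qed.
Lemma coefD x y i : coef (x + y) i = coef x i + coef y i. Proof. by []. Qed.
Lemma coefB x y i : coef (x - y) i = coef x i - coef y i. Proof. by []. Qed.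
Lemma coefZ (a : A) x i : coef (a *: x) i = a * coef x i. Proof. by []. Qed.
Lemma coef_sum (J : Type) (r : seq J) (P : pred J) (F : J -> V) i :
  coef (\sum_(j <- r | P j) F j) i = \sum_(j <- r | P j) coef (F j) i.
Proof. exact: (big_morph (fun x => coef x i) (fun x y => coefD x y i) (coef0 i)). Qed.

Lemma coef_ext x y : (forall i, coef x i = coef y i) -> x = y.
Proof. by move=> xy; apply: (@dsum_ext A nat (fun=> dga_reg A)) => i; apply: xy. Qed.

Definition below (n : nat) (x : V) := forall i, (n <= i)%N -> coef x i = 0.

Lemma below_ex x : exists n, below n x.
Proof.
have [s _ sx] := dval_fin x; exists (\max_(i <- s) i).+1 => i ni.
apply: sx; apply/negP => si; move: ni; rewrite ltnNge.
case/negP; exact: (leq_bigmax_seq (F := fun j => j) i si isT).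
Qed.

Lemma below_le m n x : (m <= n)%N -> below m x -> below n x.
Proof. by move=> mn hx i ni; apply/hx/(leq_trans mn). Qed.

Lemma below_0 n : below n 0. Proof. by []. Qed.
Lemma belowD n x y : below n x -> below n y -> below n (x + y).
Proof. by move=> hx hy i ni; rewrite coefD hx ?hy ?addr0. Qed.
Lemma belowB n x y : below n x -> below n y -> below n (x - y).
Proof. by move=> hx hy i ni; rewrite coefB hx ?hy ?subr0. Qed.
Lemma belowZ n (a : A) x : below n x -> below n (a *: x).
Proof. by move=> hx i ni; rewrite coefZ hx ?mulr0. Qed.
Lemma below_sum n (J : Type) (r : seq J) (P : pred J) (F : J -> V) :
  (forall j, P j -> below n (F j)) -> below n (\sum_(j <- r | P j) F j).
Proof.
by move=> h; apply: (big_ind (below n)) => // x y; apply: belowD.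
Qed.
Lemma below0_eq0 x : below 0 x -> x = 0.
Proof. by move=> hx; apply: coef_ext => i; apply: hx. Qed.

Lemma fsfun_subproof (f : nat -> A) n : (forall i, (n <= i)%N -> f i = 0) ->
  (f : dprod (fun _ : nat => dga_reg A)) \in @finsupp_pred A nat (fun=> dga_reg A).
Proof.
move=> fn; apply/asboolP; exists (iota 0 n) => i; rewrite mem_iota /= add0n -leqNgt.
exact: fn.
Qed.

Definition fsfun (f : nat -> A) n (fn : forall i, (n <= i)%N -> f i = 0) : V :=
  exist (fun y : dprod (fun _ : nat => dga_reg A) => 
    y \in @finsupp_pred A nat (fun=> dga_reg A)) _ (fsfun_subproof fn).

Definition ebas (j : nat) : V := @dsum_in A nat (fun=> dga_reg A) j (1 : A).

Lemma coef_ebas j i : coef (ebas j) i = if i == j then 1 else 0.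
Proof.
rewrite /coef /ebas /dval /=; case: eqP => [->|/eqP ij]; first by rewrite dfwith_in.
by rewrite dfwith_out // eq_sym.
Qed.

Lemma below_ebas j : below j.+1 (ebas j).
Proof. by move=> i ji; rewrite coef_ebas; case: eqP => // ij; lia. Qed.

Lemma fs_sum n x : below n x -> x = \sum_(j < n) coef x j *: ebas j.
Proof.
move=> hx; apply: coef_ext => i; rewrite coef_sum.
under eq_bigr do rewrite coefZ coef_ebas.
have [ni|ni] := leqP n i.
  rewrite hx // big1 // => j _; case: eqP => [ij|]; rewrite ?mulr0 //.
  by have := ltn_ord j; lia.
rewrite (bigD1 (Ordinal ni)) //= eqxx mulr1 big1 ?addr0 // => j ji.
case: eqP => [ij|]; rewrite ?mulr0 //; case/negP: ji; apply/eqP/val_inj.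
by rewrite /= -ij.
Qed.

Lemma fs_ind (P : V -> Prop) : P 0 -> (forall x y, P x -> P y -> P (x + y)) ->
  (forall a j, P (a *: ebas j)) -> forall x, P x.
Proof.
move=> P0 PD Ph x; have [n nx] := below_ex x; rewrite (fs_sum nx).
by apply: big_ind.
Qed.

Definition cmap (f : nat -> A -> A) (f0 : forall i, f i 0 = 0) : V -> V :=
  @dsum_map A nat (fun=> dga_reg A) f f0.
Arguments cmap f f0 x : clear implicits.

Lemma coef_cmap f f0 x i : coef (cmap f f0 x) i = f i (coef x i). Proof. by []. Qed.

Lemma cmap_below f f0 n x : below n x -> below n (cmap f f0 x).
Proof. by move=> hx i ni; rewrite coef_cmap hx ?f0. Qed.

Definition vsgn : V -> V := cmap (fun=> @sgn A) (fun=> sgn0 A).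

Lemma coef_vsgn x i : coef (vsgn x) i = sgn (coef x i). Proof. by []. Qed.
Lemma vsgn0 : vsgn 0 = 0.
Proof. by apply: coef_ext => i; rewrite coef_vsgn sgn0. Qed.
Lemma vsgnD x y : vsgn (x + y) = vsgn x + vsgn y.
Proof. by apply: coef_ext => i; rewrite coef_vsgn sgnD. Qed.
Lemma vsgnB x y : vsgn (x - y) = vsgn x - vsgn y.
Proof. by apply: coef_ext => i; rewrite coef_vsgn sgnB. Qed.
Lemma vsgnZ (a : A) x : vsgn (a *: x) = sgn a *: vsgn x.
Proof. by apply: coef_ext => i; rewrite coef_vsgn sgnM. Qed.
Lemma vsgn_below n x : below n x -> below n (vsgn x).
Proof. exact: cmap_below. Qed.
Lemma vsgn_ebas j : vsgn (ebas j) = ebas j.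
Proof.
apply: coef_ext => i; rewrite coef_vsgn coef_ebas.
by case: eqP; rewrite ?sgn1 ?sgn0.
Qed.

Section LinearExtension.
Variables (W : lmodType A).

Definition lin (w : nat -> W) (x : V) : W :=
  \sum_(j < sval (cid (below_ex x))) coef x j *: w j.

Lemma linE w n x : below n x -> lin w x = \sum_(j < n) coef x j *: w j.
Proof.
rewrite /lin; move: (sval _) (svalP (cid (below_ex x))) => m mx nx.
wlog mn : m n mx nx / (m <= n)%N.
  by case: (leqP m n) => [|/ltnW] mn h; [apply: h|apply/esym/h].
rewrite (big_ord_widen n (fun j => coef x j *: w j) mn) big_mkcond.
apply: eq_bigr => i _; case: ltnP => // mi.
by rewrite (mx _ mi) scale0r.
Qed.

Lemma linD w x y : lin w (x + y) = lin w x + lin w y.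
Proof.
have [m mx] := below_ex x; have [n ny] := below_ex y.
have {}mx := below_le (leq_maxl m n) mx; have {}ny := below_le (leq_maxr m n) ny.
rewrite (linE _ mx) (linE _ ny) (linE _ (belowD mx ny)) -big_split.
by apply: eq_bigr => i _; rewrite coefD scalerDl.
Qed.

Lemma linZ w (a : A) x : lin w (a *: x) = a *: lin w x.
Proof.
have [m mx] := below_ex x; rewrite (linE _ mx) (linE _ (belowZ _ mx)) scaler_sumr.
by apply: eq_bigr => i _; rewrite coefZ scalerA.
Qed.

Lemma lin0 w : lin w 0 = 0.
Proof. by rewrite (linE _ (@below_0 0)) big_ord0. Qed.

Lemma linB w x y : lin w (x - y) = lin w x - lin w y.
Proof. by rewrite linD -scaleN1r linZ scaleN1r. Qed.

Lemma lin_ebas w j : lin w (ebas j) = w j.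
Proof.
rewrite (linE _ (@below_ebas j)) big_ord_recr /= coef_ebas eqxx scale1r big1 ?add0r //.
move=> i _; rewrite coef_ebas; case: eqP => [ij|]; last by rewrite scale0r.
by have := ltn_ord i; lia.
Qed.

Lemma lin_congr n w w' x : (forall i, (i < n)%N -> w i = w' i) -> below n x ->
  lin w x = lin w' x.
Proof. by move=> ww nx; rewrite !(linE _ nx); apply: eq_bigr => i _; rewrite ww. Qed.

Definition slin (w : nat -> W) (x : V) : W := lin w (vsgn x).

Lemma slinD w x y : slin w (x + y) = slin w x + slin w y.
Proof. by rewrite /slin vsgnD linD. Qed.
Lemma slinB w x y : slin w (x - y) = slin w x - slin w y.
Proof. by rewrite /slin vsgnB linB. Qed.
Lemma slin0 w : slin w 0 = 0. Proof. by rewrite /slin vsgn0 lin0. Qed.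
Lemma slinZ w (a : A) x : slin w (a *: x) = sgn a *: slin w x.
Proof. by rewrite /slin vsgnZ linZ. Qed.
Lemma slin_ebas w j : slin w (ebas j) = w j.
Proof. by rewrite /slin vsgn_ebas lin_ebas. Qed.
Lemma slin_congr n w w' x : (forall i, (i < n)%N -> w i = w' i) -> below n x ->
  slin w x = slin w' x.
Proof. by move=> ww nx; apply: (lin_congr ww); apply: vsgn_below. Qed.

Lemma slinP (w : nat -> W) (F : V -> W) : (forall x y, F (x + y) = F x + F y) ->
  (forall (a : A) x, F (a *: x) = sgn a *: F x) -> (forall j, F (ebas j) = w j) ->
  forall x, F x = slin w x.
Proof.
move=> FD FZ Fw; apply: fs_ind => [|x y hx hy|a j].
- by rewrite slin0 -(scale0r 0) FZ sgn0 scale0r.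
- by rewrite FD slinD hx hy.
- by rewrite FZ slinZ slin_ebas Fw.
Qed.

End LinearExtension.

Lemma lin_below n (w : nat -> V) x : (forall i, (i < n)%N -> below n (w i)) ->
  below n x -> below n (lin w x).
Proof.
by move=> hw nx; rewrite (linE _ nx); apply: below_sum => i _; apply/belowZ/hw.
Qed.

(** * Semi-free DG modules *)

Definition gr (g : nat -> int) (n : int) : V -> V :=
  cmap (fun i => grg A (n - g i)) (fun i => gpr0 (grg A) (n - g i)).

Lemma coef_gr g n x i : coef (gr g n x) i = grg A (n - g i) (coef x i).
Proof. by []. Qed.

Lemma grB g n x y : gr g n (x - y) = gr g n x - gr g n y.
Proof. by apply: coef_ext => i; rewrite coef_gr gprB. Qed.

Lemma gr0 g n : gr g n 0 = 0.
Proof. by apply: coef_ext => i; rewrite coef_gr gpr0. Qed.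

Lemma gr_gr g m n x : gr g m (gr g n x) = if m == n then gr g n x else 0.
Proof.
apply: coef_ext => i; rewrite !coef_gr gpr_pr (inj_eq (addIr _)).
by case: (m == n).
Qed.

Lemma gr_fin g x : exists2 s : seq int, uniq s & x = \sum_(n <- s) gr g n x.
Proof.
have [N Nx] := below_ex x.
pose S i := sval (cid (gpr_eq0 (grg A) (coef x i))).
have SP i n : n \notin S i -> grg A n (coef x i) = 0.
  exact: (svalP (cid (gpr_eq0 (grg A) (coef x i)))).
pose t := undup (flatten [seq [seq n + g i | n <- S i] | i <- iota 0 N]).
exists t; first exact: undup_uniq.
apply: coef_ext => i; rewrite coef_sum.
have [iN|iN] := leqP N i.
  by rewrite Nx // big1 // => n _; rewrite coef_gr Nx ?gpr0.
pose t' := [seq n - g i | n <- t].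
transitivity (\sum_(n <- t') grg A n (coef x i)); last by rewrite big_map.
apply: gpr_sumE; first by rewrite map_inj_uniq ?undup_uniq //; apply: addIr.
move=> n nt; apply: SP; apply: contra nt => nS; apply/mapP.
exists (n + g i); last by rewrite addrK.
rewrite mem_undup; apply/flatten_mapP; exists i; first by rewrite mem_iota.
exact: map_f.
Qed.

Definition fsgrading g : grading V := Grading (@grB g) (@gr_gr g) (@gr_fin g).

Lemma fs_homogP g n x :
  homog (fsgrading g) n x <-> forall i, homog (grg A) (n - g i) (coef x i).
Proof.
split=> [hx i|hx]; last by apply: coef_ext => i; apply: hx.
by rewrite /homog -[in RHS]hx.
Qed.

Lemma fs_homogZ g m n (a : A) (x : V) : homog (grg A) m a ->
  homog (fsgrading g) n x -> homog (fsgrading g) (m + n) (a *: x).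
Proof.
move=> ha /fs_homogP hx; apply/fs_homogP => i.
by rewrite coefZ -addrA; apply: homogM.
Qed.

Definition fsgmod g : gmod A := GMod (@fs_homogZ g).

Lemma ebas_homog g j : homog (fsgrading g) (g j) (ebas j).
Proof.
apply/fs_homogP => i; rewrite coef_ebas; case: eqP => [->|_]; last exact: homog0.
by rewrite subrr; apply: homog1.
Qed.

Lemma gr_congr n g g' m x : (forall i, (i < n)%N -> g i = g' i) -> below n x ->
  gr g m x = gr g' m x.
Proof.
move=> gg nx; apply: coef_ext => i; rewrite !coef_gr.
by have [/nx ->|/gg ->] := leqP n i; rewrite ?gpr0.
Qed.

Lemma gr_below g n m x : below n x -> below n (gr g m x).
Proof. exact: cmap_below. Qed.

Lemma lin_homog g r (M : gmod A) (w : nat -> M) k (x : V) :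
    (forall j, (j < k)%N -> homog (gmg M) (g j + r) (w j)) -> below k x ->
  forall n, homog (fsgrading g) n x -> homog (gmg M) (n + r) (lin w x).
Proof.
move=> hw kx n /fs_homogP hx; rewrite (linE _ kx); apply: homog_sum => j _.
rewrite -(subrK (g j) n) -addrA; apply: homogZ (hx j) _.
exact: hw.
Qed.

Lemma vsgn_homog g n x : homog (fsgrading g) n x -> homog (fsgrading g) n (vsgn x).
Proof. by move=> /fs_homogP hx; apply/fs_homogP => i; apply: homog_sgn. Qed.

Lemma slin_homog g r (M : gmod A) (w : nat -> M) k (x : V) :
    (forall j, (j < k)%N -> homog (gmg M) (g j + r) (w j)) -> below k x ->
  forall n, homog (fsgrading g) n x -> homog (gmg M) (n + r) (slin w x).
Proof. by move=> hw kx n hx; apply: (lin_homog hw (vsgn_below kx)); apply: vsgn_homog. Qed.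

Definition dT (b : nat -> V) (x : V) : V := cmap (fun=> dgad A) (fun=> diff0 (dgad A)) x + slin b x.

Lemma dTD b x y : dT b (x + y) = dT b x + dT b y.
Proof.
rewrite /dT slinD addrACA; congr (_ + _).
by apply: coef_ext => i; rewrite coef_cmap coefD diffD.
Qed.

Lemma dTZ b (a : A) x : dT b (a *: x) = dgad A a *: x + sgn a *: dT b x.
Proof.
rewrite /dT slinZ scalerDr addrA; congr (_ + _).
by apply: coef_ext => i; rewrite coef_cmap coefZ dga_leibniz_sgn.
Qed.

Lemma dT_ebas b j : dT b (ebas j) = b j.
Proof.
rewrite /dT slin_ebas (_ : cmap _ _ _ = 0) ?add0r //; apply: coef_ext => i.
by rewrite coef_cmap coef_ebas; case: eqP; rewrite ?dga_d1 ?diff0.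
Qed.

Lemma dT0 b : dT b 0 = 0.
Proof. by rewrite -[in LHS](scale0r (0 : V)) dTZ sgn0 !scale0r scaler0 addr0. Qed.

Lemma dTN b x : dT b (- x) = - dT b x.
Proof. by apply/eqP; rewrite -addr_eq0 -dTD addNr dT0. Qed.

Lemma dTB b x y : dT b (x - y) = dT b x - dT b y.
Proof. by rewrite dTD dTN. Qed.

Lemma dT_congr n b b' x : (forall i, (i < n)%N -> b i = b' i) -> below n x ->
  dT b x = dT b' x.
Proof. by move=> bb nx; rewrite /dT (slin_congr bb nx). Qed.

Lemma dT_below n b x : (forall i, (i < n)%N -> below i (b i)) -> below n x ->
  below n (dT b x).
Proof.
move=> hb nx; apply: belowD; first exact: cmap_below.
apply: lin_below (vsgn_below nx) => i lin; apply: below_le (hb _ lin).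
exact: ltnW.
Qed.

Lemma dT_top n b x : (forall i, (i <= n)%N -> below i (b i)) -> below n.+1 x ->
  coef (dT b x) n = dgad A (coef x n).
Proof.
move=> hb nx; rewrite coefD coef_cmap /slin (linE _ (vsgn_below nx)) coef_sum.
rewrite big1 ?addr0 // => i _; rewrite coefZ hb ?mulr0 //; last by rewrite -ltnS.
by rewrite -ltnS.
Qed.

Lemma dT_homog g n b x : (forall i, (i < n)%N -> homog (fsgrading g) (g i - 1) (b i)) ->
  below n x -> forall m, homog (fsgrading g) m x -> homog (fsgrading g) (m - 1) (dT b x).
Proof.
move=> hb nx m hx; apply: homogD.
  move/fs_homogP: hx => hx; apply/fs_homogP => i.
  by rewrite coef_cmap addrAC; apply: diff_homog.
exact: (@slin_homog g (-1) (fsgmod g) b n).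
Qed.

Lemma dTK_below n b x : (forall i, (i < n)%N -> dT b (b i) = 0) ->
  below n x -> dT b (dT b x) = 0.
Proof.
move=> hb nx; rewrite (fs_sum nx) !(big_morph _ (dTD b) (dT0 b)) big1 // => i _.
rewrite dTZ dT_ebas dTD !dTZ dT_ebas diffK hb // sgn_diff scale0r add0r scaler0 addr0.
by rewrite scaleNr addNr.
Qed.

(* A twisted differential d(e_j) = b_j on the free module on e_0, e_1, ...   *)
(* with e_j in degree g_j.                                                   *)
Record semifree := Semifree {
  sfg : nat -> int;
  sfb : nat -> V;
  sfb_below : forall j, below j (sfb j);
  sfb_homog : forall j, homog (fsgrading sfg) (sfg j - 1) (sfb j);
  sfb_cycle : forall j, dT sfb (sfb j) = 0 }.

Section SemifreeModule.
Variable T : semifree.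

Lemma sf_dK x : dT (sfb T) (dT (sfb T) x) = 0.
Proof.
have [n nx] := below_ex x; apply: dTK_below nx => i _; exact: sfb_cycle.
Qed.

Lemma sf_dhomog n x : homog (fsgrading (sfg T)) n x ->
  homog (fsgrading (sfg T)) (n - 1) (dT (sfb T) x).
Proof.
have [k kx] := below_ex x; apply: dT_homog kx n => i _; exact: sfb_homog.
Qed.

Definition sfdiff : differential (gmg (fsgmod (sfg T))) :=
  Differential (dTB (sfb T)) sf_dK sf_dhomog.

Lemma sf_leibniz n (a : A) (x : fsgmod (sfg T)) : homog (grg A) n a ->
  sfdiff (a *: x) = dgad A a *: x + ksign A n *: (a *: sfdiff x).
Proof. by move=> ha; rewrite /= dTZ (sgn_homog ha) scalerA. Qed.

Definition sfmod : dgmod A := DGMod sf_leibniz.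

Lemma sfdE x : dgmd sfmod x = dT (sfb T) x. Proof. by []. Qed.

Lemma sf_dgr n x : dT (sfb T) (gr (sfg T) n x) = gr (sfg T) (n - 1) (dT (sfb T) x).
Proof. exact: (diff_pr sfdiff n x). Qed.

End SemifreeModule.

End FreeModule.

Arguments cmap {A} f f0 x.

(** * Morphisms and homotopies *)

Section SubMorphism.
Variables (U V : zmodType) (f : U -> V).
Hypothesis fB : forall x y, f (x - y) = f x - f y.

Lemma subr_morph0 : f 0 = 0.
Proof. by rewrite -[X in f X](subrr 0) fB subrr. Qed.

Lemma subr_morphD x y : f (x + y) = f x + f y.
Proof. by rewrite -{1}(opprK y) fB -(sub0r y) fB subr_morph0 sub0r opprK. Qed.

End SubMorphism.

Section BuildHom.
Variables (R : gring) (M N : gmod R) (F : M -> N).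
Hypotheses (FD : forall x y, F (x + y) = F x + F y).
Hypotheses (FZ : forall (a : R) x, F (a *: x) = a *: F x).
Hypotheses (FG : forall n x, homog (gmg M) n x -> homog (gmg N) n (F x)).

Lemma build_linear : linear F.
Proof. by move=> a x y; rewrite FD FZ. Qed.

Definition build_lin : {linear M -> N} :=
  HB.pack F (@GRing.isLinear.Build R M N *:%R F build_linear).

Lemma build_gpr n x : build_lin (gmg M n x) = gmg N n (build_lin x).
Proof.
have F0 : F 0 = 0 by rewrite -(scale0r 0) FZ scale0r.
rewrite /=; elim/(homog_ind (G := gmg M)): x => [|x y hx hy|m x hx].
- by rewrite gpr0 F0 gpr0.
- by rewrite gprD !FD gprD hx hy.
by rewrite (homog_prE _ hx) (homog_prE _ (FG hx)); case: eqP.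
Qed.

Definition build_gmod_hom : gmod_hom M N := GModHom build_gpr.

End BuildHom.

Section HomTheory.
Variables (R : gring) (M N : gmod R) (f : gmod_hom M N).

Lemma ghD x y : f (x + y) = f x + f y. Proof. exact: raddfD. Qed.
Lemma ghB x y : f (x - y) = f x - f y. Proof. exact: raddfB. Qed.
Lemma gh0 : f 0 = 0. Proof. exact: raddf0. Qed.
Lemma ghZ (a : R) x : f (a *: x) = a *: f x. Proof. by rewrite linearZ. Qed.

End HomTheory.

Lemma gmod_hom_homog (R : gring) (M N : gmod R) (f : gmod_hom M N) n x :
  homog (gmg M) n x -> homog (gmg N) n (f x).
Proof. by rewrite /homog -gmod_fun_pr => ->. Qed.

Definition build_dgmod_hom (A : dga) (M N : dgmod A) (F : M -> N) FD FZ FG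
  (Fd : forall x, F (dgmd M x) = dgmd N (F x)) : dgmod_hom M N :=
  @DGModHom A M N (@build_gmod_hom A M N F FD FZ FG) Fd.

Section HomAlgebra.
Variables (A : dga) (M N P : dgmod A).

Definition dgmod_comp (f : dgmod_hom N P) (h : dgmod_hom M N) : dgmod_hom M P.
Proof.
apply: (@build_dgmod_hom A M P (f \o h)) => /=.
- by move=> x y; rewrite !ghD.
- by move=> a x; rewrite !ghZ.
- by move=> n x hx; do 2!apply: gmod_hom_homog.
- by move=> x; rewrite !dgmod_fun_d.
Defined.

End HomAlgebra.

Section Homotopy.
Variable A : dga.
Implicit Types M N : dgmod A.

Lemma homotopic_refl M N (f : M -> N) : homotopic f f.
Proof.
exists (fun=> 0); split=> [x y|n x _|n a x _|x]; first by rewrite subr0.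
- exact: homog0.
- by rewrite !scaler0.
- by rewrite subrr diff0 addr0.
Qed.

Lemma homotopic_sym M N (f g : M -> N) : homotopic f g -> homotopic g f.
Proof.
move=> [h [hB hG hZ hE]]; exists (fun x => - h x); split.
- by move=> x y; rewrite hB opprD.
- by move=> n x /hG; apply: homogN.
- by move=> n a x ha; rewrite (hZ _ _ _ ha) !scalerN.
- by move=> x; rewrite -opprB hE diffN opprD.
Qed.

Lemma homotopic_trans M N (f g k : M -> N) :
  homotopic f g -> homotopic g k -> homotopic f k.
Proof.
move=> [h [hB hG hZ hE]] [l [lB lG lZ lE]]; exists (fun x => h x + l x); split.
- by move=> x y; rewrite hB lB opprD addrACA.
- by move=> n x hx; apply: homogD; [apply: hG|apply: lG].
- by move=> n a x ha; rewrite (hZ _ _ _ ha) (lZ _ _ _ ha) !scalerDr.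
- by move=> x; rewrite -(subrK (g x) (f x)) -addrA hE lE diffD addrACA.
Qed.

Lemma homotopic_post M N P (p : dgmod_hom N P) (f g : M -> N) :
  homotopic f g -> homotopic (p \o f) (p \o g).
Proof.
move=> [h [hB hG hZ hE]]; exists (p \o h); split=> /=.
- by move=> x y; rewrite hB ghB.
- by move=> n x /hG; apply: gmod_hom_homog.
- by move=> n a x ha; rewrite (hZ _ _ _ ha) !ghZ.
- by move=> x; rewrite -ghB hE ghD; congr (_ + _); apply: dgmod_fun_d.
Qed.

Lemma homotopic_pre M N P (p : dgmod_hom P M) (f g : M -> N) :
  homotopic f g -> homotopic (f \o p) (g \o p).
Proof.
move=> [h [hB hG hZ hE]]; exists (h \o p); split=> /=.
- by move=> x y; rewrite ghB hB.
- by move=> n x hx; apply/hG/gmod_hom_homog.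
- by move=> n a x ha; rewrite ghZ (hZ _ _ _ ha).
- by move=> x; rewrite hE; congr (_ + _); rewrite /= -dgmod_fun_d.
Qed.

Lemma homotopy_sgn M N (h : M -> N) : (forall x y, h (x - y) = h x - h y) ->
  (forall n (a : A) x, homog (grg A) n a -> h (a *: x) = ksign A n *: (a *: h x)) ->
  forall (a : A) x, h (a *: x) = sgn a *: h x.
Proof.
move=> hB hZ.
have h0 := subr_morph0 hB; have hD := subr_morphD hB.
move=> a x; elim/(homog_ind (G := grg A)): a => [|u v hu hv|n a ha].
- by rewrite scale0r sgn0 scale0r h0.
- by rewrite scalerDl hD hu hv sgnD scalerDl.
by rewrite (hZ n) // (sgn_homog ha) scalerA.
Qed.

End Homotopy.

(* A quasi-isomorphism has acyclic mapping cone, in elementwise form. *)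
Lemma quasi_isoP (V W : zmodType) (GV : grading V) (GW : grading W)
    (dV : differential GV) (dW : differential GW) (f : V -> W) :
  (forall x y, f (x - y) = f x - f y) -> (forall x, f (dV x) = dW (f x)) ->
  quasi_iso dV dW f <-> (forall y z, dV y = 0 -> f y = dW z ->
    exists m n, dV m = y /\ f m = z + dW n).
Proof.
move=> fB fd; have f0 := subr_morph0 fB.
split=> [[inj sur] y z dy fy|cone].
  have [m0 ym0] := inj _ dy (ex_intro _ z fy).
  have [|m1 [dm1 [n fE]]] := sur (f m0 - z).
    by rewrite diffB -fd -ym0 fy subrr.
  exists (m0 - m1), n; split; first by rewrite diffB dm1 subr0.
  by rewrite fB; apply/eqP; rewrite subr_eq addrAC -addrA -fE addrC subrK.
split=> [x dx [y fx]|y dy].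
  by have [m [n [<- _]]] := cone _ _ dx fx; exists m.
have [||m [n [dm fm]]] := cone 0 y; rewrite ?diff0 ?f0 ?dy //.
by exists m; split=> //; exists (- n); rewrite fm diffN addrK.
Qed.

Lemma qis_cone (A : dga) (M N : dgmod A) (p : dgmod_hom M N) r y z :
  dgmod_quasi_iso p -> homog (gmg M) r y -> homog (gmg N) (r + 1) z ->
  dgmd M y = 0 -> p y = dgmd N z ->
  exists m n, [/\ homog (gmg M) (r + 1) m, homog (gmg N) (r + 2) n,
    dgmd M m = y & p m = z + dgmd N n].
Proof.
move=> pq hy hz dy py.
have [pc _] := quasi_isoP (dV := dgmd M) (dW := dgmd N) (ghB p) (dgmod_fun_d p).
have [m [n [dm pm]]] := pc pq y z dy py.
exists (gmg M (r + 1) m), (gmg N (r + 2) n).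
split; try exact: homog_gpr; first by rewrite diff_pr addrK dm.
by rewrite gmod_fun_pr pm gprD hz diff_pr -addrA.
Qed.

(** * Semi-free modules are homotopically projective *)

Section SemifreeMaps.
Variables (A : dga) (T : semifree A) (M : dgmod A).
Notation b := (sfb T).
Notation g := (sfg T).
Notation e := (ebas A).

Lemma lin_chain n (m : nat -> M) x :
  (forall j, (j < n)%N -> dgmd M (m j) = lin m (b j)) -> below n x ->
  dgmd M (lin m x) = lin m (dT b x).
Proof.
move=> hm nx; rewrite (fs_sum nx); rewrite !(big_morph _ (linD m) (lin0 m)).
rewrite diff_sum (big_morph _ (dTD b) (dT0 b)) (big_morph _ (linD m) (lin0 m)).
apply: eq_bigr => j _.
by rewrite dTZ dT_ebas linD !linZ lin_ebas dgmod_leibniz_sgn hm.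
Qed.

(* F is typically a difference of two chain maps. *)
Lemma slin_homotopy n (m : nat -> M) (F : fsmod A -> M) x :
  (forall x y, F (x + y) = F x + F y) -> (forall (a : A) x, F (a *: x) = a *: F x) ->
  (forall j, (j < n)%N -> F (e j) = dgmd M (m j) + slin m (b j)) -> below n x ->
  F x = dgmd M (slin m x) + slin m (dT b x).
Proof.
move=> FD FZ hm nx; have F0 : F 0 = 0 by rewrite -(scale0r 0) FZ scale0r.
rewrite (fs_sum nx) (big_morph _ FD F0) (big_morph _ (slinD m) (slin0 m)).
rewrite diff_sum (big_morph _ (dTD b) (dT0 b)) (big_morph _ (slinD m) (slin0 m)).
rewrite -big_split; apply: eq_bigr => j _ /=.
rewrite FZ hm // dTZ dT_ebas slinD !slinZ slin_ebas dgmod_leibniz_sgn sgnK sgn_diff.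
by rewrite scaleNr addrACA subrr add0r scalerDr.
Qed.

Lemma lin_homotopy n (m k : nat -> M) (h : fsmod A -> M) x :
  (forall x y, h (x + y) = h x + h y) -> (forall (a : A) x, h (a *: x) = sgn a *: h x) ->
  (forall j, (j < n)%N -> k j = h (e j) + dgmd M (m j) - lin m (b j)) -> below n x ->
  slin k x = h x + dgmd M (lin m x) - lin m (dT b x).
Proof.
move=> hD hZ hm nx; have h0 : h 0 = 0 by rewrite -(scale0r 0) hZ sgn0 scale0r.
rewrite (fs_sum nx) (big_morph _ hD h0) (big_morph _ (slinD k) (slin0 k)).
rewrite (big_morph _ (linD m) (lin0 m)).
rewrite diff_sum (big_morph _ (dTD b) (dT0 b)) (big_morph _ (linD m) (lin0 m)).
rewrite -big_split -sumrB; apply: eq_bigr => j _ /=.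
rewrite hZ slinZ slin_ebas hm // dTZ dT_ebas linD !linZ lin_ebas dgmod_leibniz_sgn.
rewrite scalerBr scalerDr -!addrA; congr (_ + _).
by rewrite [RHS]addrCA opprD addNKr.
Qed.

Lemma sf_hom_ex (m : nat -> M) : (forall j, homog (gmg M) (g j) (m j)) ->
  (forall j, dgmd M (m j) = lin m (b j)) ->
  exists f : dgmod_hom (sfmod T) M, (f : _ -> _) = lin m.
Proof.
move=> hm dm; have lh n (x : sfmod T) :
    homog (gmg (sfmod T)) n x -> homog (gmg M) n (lin m x).
  have [k kx] := below_ex x; rewrite -[X in _ -> homog _ X _]addr0 => hx.
  by apply: (lin_homog (g := g) _ kx hx) => j _; rewrite addr0.
have ld (x : sfmod T) : lin m (dgmd (sfmod T) x) = dgmd M (lin m x).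
  have [k kx] := below_ex x; rewrite (lin_chain _ kx) // => j _; exact: dm.
by exists (@build_dgmod_hom A (sfmod T) M (lin m) (linD m) (linZ m) lh ld).
Qed.

Lemma sf_homotopic_ex (f f' : dgmod_hom (sfmod T) M) (m : nat -> M) :
  (forall j, homog (gmg M) (g j + 1) (m j)) ->
  (forall j, f (e j) - f' (e j) = dgmd M (m j) + slin m (b j)) ->
  homotopic f f'.
Proof.
move=> hm fm; exists (slin m); split.
- by move=> x y; apply: slinB.
- move=> n x hx; have [k kx] := below_ex x.
  exact: (slin_homog (g := g) (fun j _ => hm j) kx hx).
- by move=> n a x ha; rewrite slinZ (sgn_homog ha) scalerA.
move=> x; have [k kx] := below_ex x.
apply: (slin_homotopy (n := k) (F := fun x => f x - f' x)) => // y z.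
  by rewrite !ghD opprD addrACA.
by rewrite !ghZ scalerBr.
Qed.

End SemifreeMaps.

Section Lifting.
Variables (A : dga) (T : semifree A) (M N : dgmod A) (p : dgmod_hom M N).
Hypothesis pq : dgmod_quasi_iso p.
Notation b := (sfb T).
Notation g := (sfg T).
Notation e := (ebas A).

Lemma hom_slin (w : nat -> M) x : p (slin w x) = slin (p \o w) x.
Proof.
apply: (slinP (F := fun x => p (slin w x))) => [y z|a y|j]; first by rewrite slinD ghD.
- by rewrite slinZ ghZ.
- by rewrite slin_ebas.
Qed.

Lemma sf_lift (f : dgmod_hom (sfmod T) N) :
  exists l : dgmod_hom (sfmod T) M, homotopic (p \o l) f.
Proof.
pose Q j (w : nat -> M * N) (v : M * N) :=
  [/\ homog (gmg M) (g j) v.1, homog (gmg N) (g j + 1) v.2,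
      dgmd M v.1 = lin (fun i => (w i).1) (b j)
    & p v.1 - f (e j) = dgmd N v.2 + slin (fun i => (w i).2) (b j)].
have [|j w wQ|w wQ] := @seq_choice (M * N)%type (0, 0) Q.
- move=> j w w' v ww [h1 h2 h3 h4]; split=> //.
  + by rewrite h3; apply: (lin_congr (n := j)); [move=> i /ww ->|exact: sfb_below].
  + by rewrite h4; congr (_ + _); apply: (slin_congr (n := j)); [move=> i /ww ->|exact: sfb_below].
- set m := fun i => (w i).1; set n := fun i => (w i).2.
  have bj := sfb_below T (j := j).
  have bh := sfb_homog T j.
  have e1 : dgmd M (lin m (b j)) = 0.
    rewrite (lin_chain (T := T) _ bj) ?sfb_cycle ?lin0 // => i /wQ[]//.
  have e2 : p (lin m (b j)) - f (b j) = dgmd N (slin n (b j)).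
    rewrite -[RHS]addr0 -(slin0 n) -(sfb_cycle T j).
    apply: (slin_homotopy (n := j) (F := fun x => p (lin m x) - f x)) bj.
    + by move=> x y; rewrite linD !ghD opprD addrACA.
    + by move=> a x; rewrite linZ !ghZ scalerBr.
    + by move=> i /wQ[_ _ _]; rewrite lin_ebas.
  have hy : homog (gmg M) (g j - 1) (lin m (b j)).
    rewrite -[X in homog _ X]addr0; apply: (lin_homog (g := g) _ bj bh) => i /wQ[].
    by rewrite addr0.
  have hz : homog (gmg N) (g j - 1 + 1) (f (e j) + slin n (b j)).
    rewrite subrK; apply: homogD.
      by apply: gmod_hom_homog; apply: ebas_homog.
    rewrite -(subrK 1 (g j)); apply: (slin_homog (g := g) _ bj bh) => i /wQ[].
    by rewrite addrC.
  have [|u [v [h1 h2 h3 h4]]] := qis_cone pq hy hz e1.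
    by rewrite diffD -e2 -dgmod_fun_d sfdE dT_ebas addrC subrK.
  exists (u, v); split=> //=; first by rewrite subrK in h1.
    by rewrite -[_ + 2]/(g j - 1 + (1 + 1)) addrA subrK in h2.
  by rewrite h4 addrC !addrA addNr add0r addrC.
have [||l lE] := @sf_hom_ex A T M (fun j => (w j).1); try by move=> j; case: (wQ j).
exists l; rewrite -[X in homotopic X](_ : (dgmod_comp p l : _ -> _) = _) //.
apply: (sf_homotopic_ex (m := fun j => (w j).2)) => j; first by case: (wQ j).
by case: (wQ j) => _ _ _ <-; rewrite /= lE lin_ebas.
Qed.

Lemma sf_lift_unique (f f' : dgmod_hom (sfmod T) M) :
  homotopic (p \o f) (p \o f') -> homotopic f f'.
Proof.
move=> [h [hB hG hZ hE]].
have {}hZ := homotopy_sgn hB hZ.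
have h0 := subr_morph0 hB; have hD := subr_morphD hB.
pose Q j (w : nat -> M * N) (v : M * N) :=
  [/\ homog (gmg M) (g j + 1) v.1, homog (gmg N) (g j + 2) v.2,
      f (e j) - f' (e j) = dgmd M v.1 + slin (fun i => (w i).1) (b j)
    & p v.1 = h (e j) + dgmd N v.2 - lin (fun i => (w i).2) (b j)].
have [|j w wQ|w wQ] := @seq_choice (M * N)%type (0, 0) Q.
- move=> j w w' v ww [h1 h2 h3 h4]; split=> //.
  + by rewrite h3; congr (_ + _); apply: (slin_congr (n := j)); [move=> i /ww ->|exact: sfb_below].
  + by rewrite h4; congr (_ - _); apply: (lin_congr (n := j)); [move=> i /ww ->|exact: sfb_below].
- set m := fun i => (w i).1; set n := fun i => (w i).2.
  have bj := sfb_below T (j := j).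
  have bh := sfb_homog T j.
  have e1 : f (b j) - f' (b j) = dgmd M (slin m (b j)).
    rewrite -[RHS]addr0 -(slin0 m) -(sfb_cycle T j).
    apply: (slin_homotopy (n := j) (F := fun x => f x - f' x)) bj.
    + by move=> x y; rewrite !ghD opprD addrACA.
    + by move=> a x; rewrite !ghZ scalerBr.
    + by move=> i /wQ[].
  have e2 : slin (p \o m) (b j) = h (b j) + dgmd N (lin n (b j)).
    rewrite -[RHS]subr0 -(lin0 n) -(sfb_cycle T j).
    by apply: (lin_homotopy (n := j) (h := h)) bj => // i /wQ[].
  have hy : homog (gmg M) (g j) (f (e j) - f' (e j) - slin m (b j)).
    apply: homogB; first by apply: homogB; apply: gmod_hom_homog; apply: ebas_homog.
    rewrite -(subrK 1 (g j)); apply: (slin_homog (g := g) _ bj bh) => i /wQ[].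
    by rewrite addrC.
  have hz : homog (gmg N) (g j + 1) (h (e j) - lin n (b j)).
    apply: homogB; first by apply: hG; apply: ebas_homog.
    rewrite (_ : g j + 1 = g j - 1 + 2); last by lia.
    by apply: (lin_homog (g := g) _ bj bh) => i /wQ[].
  have e3 : dgmd M (f (e j) - f' (e j) - slin m (b j)) = 0.
    by rewrite !diffB -!dgmod_fun_d sfdE dT_ebas e1 subrr.
  have [|u [v [h1 h2 h3 h4]]] := qis_cone pq hy hz e3.
    rewrite !ghB diffB hom_slin e2 [X in X - _](hE (e j)) sfdE dT_ebas.
    by rewrite opprD addrA addrK.
  exists (u, v); split=> //=; first by rewrite h3 subrK.
  by rewrite h4 addrAC.
apply: (sf_homotopic_ex (m := fun j => (w j).1)) => j; first by case: (wQ j).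
by case: (wQ j).
Qed.

End Lifting.

(** * Compactness *)

Definition dgmod_idhom (A : dga) (M : dgmod A) : dgmod_hom M M :=
  @build_dgmod_hom A M M id (fun _ _ => erefl) (fun _ _ => erefl)
    (fun _ _ h => h) (fun=> erefl).

Section ZeroHom.
Variables (A : dga) (M N : dgmod A).

Lemma zero_homD (x y : M) : 0 = 0 + 0 :> N. Proof. by rewrite addr0. Qed.
Lemma zero_homZ (a : A) (x : M) : 0 = a *: 0 :> N. Proof. by rewrite scaler0. Qed.

Definition dgmod_zero : dgmod_hom M N :=
  @build_dgmod_hom A M N (fun=> 0) zero_homD zero_homZ
    (fun n _ _ => homog0 (gmg N) n) (fun=> esym (diff0 (dgmd N))).

End ZeroHom.

Section DirectSumProjection.
Variables (A : dga) (I : choiceType) (M : I -> dgmod A).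

Definition dproj (i : I) : dgmod_hom (dsum M) (M i) :=
  @build_dgmod_hom A (dsum M) (M i) (fun x => dval x i)
    (fun _ _ => erefl) (fun _ _ => erefl)
    (fun n x => (dsum_homogP n x).1 ^~ i) (fun=> erefl).

Lemma dval_in (i j : I) (F : forall i, M i) :
  dval (dsum_in (F i)) j = if j == i then F j else 0.
Proof.
rewrite /dsum_in /dval /=; case: eqP => [->|/eqP ij].
  by rewrite dfwith_in.
by rewrite dfwith_out // eq_sym.
Qed.

Lemma dval_sum_in (s : seq I) (F : forall i, M i) j : uniq s ->
  dval (\sum_(i <- s) dsum_in (F i) : dsum M) j = if j \in s then F j else 0.
Proof.
move=> us; rewrite dval_sum.
under eq_bigr => i _ do rewrite dval_in.
case: ifP => [js|/negP js]; last first.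
  rewrite big1_seq // => i /andP[_ si]; case: eqP => // ji.
  by case: js; rewrite ji.
rewrite (bigD1_seq j) //= eqxx big1 ?addr0 // => i ij.
by rewrite eq_sym (negbTE ij).
Qed.

End DirectSumProjection.

Section Truncation.
Variable A : dga.
Notation V := (fsmod A).

Lemma trunc_subproof n (i : nat) : (if (i < n)%N then 0 else 0) = 0 :> A.
Proof. by case: ifP. Qed.

Definition tr (n : nat) : V -> V :=
  cmap (fun i a => if (i < n)%N then 0 else a) (trunc_subproof n).

Lemma coef_tr n x i : coef (tr n x) i = if (i < n)%N then 0 else coef x i.
Proof. by []. Qed.

Lemma trD n x y : tr n (x + y) = tr n x + tr n y.
Proof.
by apply: coef_ext => i; rewrite coefD !coef_tr; case: ifP; rewrite ?addr0.
Qed.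

Lemma trZ n (a : A) x : tr n (a *: x) = a *: tr n x.
Proof.
by apply: coef_ext => i; rewrite coefZ !coef_tr; case: ifP; rewrite ?mulr0.
Qed.

Lemma trB n x y : tr n (x - y) = tr n x - tr n y.
Proof. by rewrite trD -scaleN1r trZ scaleN1r. Qed.

Lemma tr0 n : tr n 0 = 0.
Proof. by rewrite -[X in tr n X](subrr 0) trB subrr. Qed.

Lemma tr_eq0 n x : tr n x = 0 <-> below n x.
Proof.
split=> [tx i ni|nx]; last first.
  by apply: coef_ext => i; rewrite coef_tr; case: ltnP => // /nx ->.
by move: (congr1 (fun y => coef y i) tx); rewrite /= coef_tr ltnNge ni.
Qed.

Lemma tr_below k n x : below n x -> below n (tr k x).
Proof. exact: cmap_below. Qed.

Lemma trK n x : tr n (tr n x) = tr n x.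
Proof. by apply: coef_ext => i; rewrite !coef_tr; case: (i < n)%N. Qed.

Lemma tr_homog g n m x : homog (fsgrading A g) m x -> homog (fsgrading A g) m (tr n x).
Proof.
move=> /fs_homogP hx; apply/fs_homogP => i; rewrite coef_tr.
by case: ifP => _; [apply: homog0|apply: hx].
Qed.

Lemma vsgn_tr n x : vsgn (tr n x) = tr n (vsgn x).
Proof.
by apply: coef_ext => i; rewrite coef_vsgn !coef_tr; case: ifP; rewrite ?sgn0.
Qed.

Lemma tr_dT n b x : (forall j, below j (b j)) ->
  tr n (dT b x) = dT (fun j => tr n (b j)) (tr n x).
Proof.
move=> hb; rewrite /dT trD; congr (_ + _).
  apply: coef_ext => i; rewrite coef_tr !coef_cmap.
  by case: (i < n)%N; rewrite ?diff0.
rewrite /slin vsgn_tr; move: (vsgn x) => {}x; elim/fs_ind: x => [|x y hx hy|a j].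
- by rewrite lin0 tr0 lin0.
- by rewrite linD !trD linD hx hy.
rewrite linZ !trZ linZ lin_ebas; congr (_ *: _).
have [jn|nj] := ltnP j n.
  rewrite ((tr_eq0 n (ebas A j)).2 _) ?lin0; last exact: below_le (@below_ebas A j).
  by apply/tr_eq0/(below_le (ltnW jn))/hb.
rewrite (_ : tr n (ebas A j) = ebas A j) ?lin_ebas //; apply: coef_ext => i.
by rewrite coef_tr coef_ebas; case: ltnP => //; case: eqP => //; lia.
Qed.

Variable T : semifree A.

Lemma sftr_below n j : below j (tr n (sfb T j)).
Proof. exact/tr_below/sfb_below. Qed.

Lemma sftr_homog n j : homog (fsgrading A (sfg T)) (sfg T j - 1) (tr n (sfb T j)).
Proof. exact/tr_homog/sfb_homog. Qed.

Lemma sftr_cycle n j : dT (fun j => tr n (sfb T j)) (tr n (sfb T j)) = 0.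
Proof. by rewrite -tr_dT ?sfb_cycle ?tr0 // => i; apply: sfb_below. Qed.

Definition sftr n : semifree A :=
  Semifree (sftr_below n) (@sftr_homog n) (sftr_cycle n).

Definition trhom n : dgmod_hom (sfmod T) (sfmod (sftr n)) :=
  @build_dgmod_hom A (sfmod T) (sfmod (sftr n)) (tr n) (trD n) (trZ n)
    (fun m x => @tr_homog (sfg T) n m x) (fun x => tr_dT n x (@sfb_below A T)).

End Truncation.

Section Bounded.
Variables (A : dga) (T : semifree A).
Notation b := (sfb T).
Notation g := (sfg T).
Notation e := (ebas A).

(* The identity of T is homotopic, by the homotopy with values w_j on e_j,   *)
(* to a map into the submodule spanned by e_0, ..., e_(n-1).                 *)
Definition sf_bounded : Prop := exists n (w : nat -> fsmod A),
  (forall j, homog (fsgrading A g) (g j + 1) (w j)) /\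
  forall j, below n (e j - dT b (w j) - slin w (b j)).

Lemma null_bounded n : homotopic (trhom T n) (fun=> 0) -> sf_bounded.
Proof.
move=> [h [hB hG hZ hE]]; exists n, (fun j => h (e j)); split=> [j|j].
  by apply: hG; apply: ebas_homog.
have hD := subr_morphD hB.
have hb : h (b j) = slin (fun j => h (e j)) (b j).
  exact: (slinP (F := h) hD (homotopy_sgn hB hZ)).
have := hE (e j); rewrite /= subr0 dT_ebas => {}hE.
apply/tr_eq0; rewrite !trB tr_dT; last exact: sfb_below.
rewrite -(trK n (e j)) hE trD tr_dT; last by move=> i; apply/tr_below/sfb_below.
rewrite -hb addrAC addrK (_ : (fun i => tr n (tr n (b i))) = fun i => tr n (b i)).
  by rewrite subrr.
by apply/funext => i; rewrite trK.
Qed.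

Lemma retract_bounded n (r : fsmod A -> fsmod A) :
  @homotopic A (sfmod T) (sfmod T) id r -> (forall x, below n (r x)) -> sf_bounded.
Proof.
move=> [h [hB hG hZ hE]] rn; exists n, (fun j => h (e j)); split=> [j|j].
  by apply: hG; apply: ebas_homog.
have -> : slin (fun j => h (e j)) (b j) = h (b j).
  exact/esym/(slinP (F := h) (subr_morphD hB) (homotopy_sgn hB hZ)).
rewrite -addrA -opprD (_ : dT b (h (e j)) + h (b j) = e j - r (e j)); first by rewrite subKr.
by rewrite -(dT_ebas b j); apply/esym/(hE (e j)).
Qed.

Lemma bounded_retract : sf_bounded -> exists n (r : dgmod_hom (sfmod T) (sfmod T)),
  homotopic id r /\ forall x, below n (r x).
Proof.
move=> [n [w [wh wn]]].
pose r j := e j - dT b (w j) - slin w (b j).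
have slw := slinP (slinD w) (slinZ w) (slin_ebas w).
have [|j|f fE] := @sf_hom_ex A T (sfmod T) r.
- move=> j; apply: homogB; first apply: homogB.
  + exact: ebas_homog.
  + by rewrite -[g j](addrK 1); apply: sf_dhomog.
  + have bj := sfb_below T (j := j).
    rewrite -(subrK 1 (g j)).
    exact: (@slin_homog _ g 1 (sfmod T) w _ _ (fun i _ => wh i) bj _ (sfb_homog T j)).
- have rE x : lin r x = x - dT b (slin w x) - slin w (dT b x).
    have [k kx] := below_ex x.
    have := @slin_homotopy A T (sfmod T) k w (fun x => x - lin r x) x.
    move=> H; rewrite -[LHS](subKr x) H //.
    + by rewrite opprD addrA.
    + by move=> y z; rewrite linD opprD addrACA.
    + by move=> a y; rewrite linZ scalerBr.
    + move=> i _; rewrite lin_ebas /r.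
      by rewrite -addrA -opprD subKr.
  rewrite rE sfb_cycle slin0 subr0.
  by rewrite sfdE /r !dTB sf_dK subr0 dT_ebas.
exists n, f; split; last first.
  move=> x; rewrite fE; have [k kx] := below_ex x; rewrite (linE _ kx).
  by apply: below_sum => i _; apply/belowZ/wn.
apply: (@sf_homotopic_ex A T (sfmod T) (dgmod_idhom _) f w) => // j.
by rewrite /= fE lin_ebas /r -addrA -opprD subKr.
Qed.

End Bounded.

Section Compact.
Variables (A : dga) (X : dgmod A) (T : semifree A) (q : dgmod_hom (sfmod T) X).
Hypothesis qq : dgmod_quasi_iso q.

Lemma compact_bounded : compact_object X -> sf_bounded T.
Proof.
pose M n := sfmod (sftr T n).
have fin x : ((fun n => tr n x) : dprod M) \in @finsupp_pred A nat M.
  apply/asboolP; have [k kx] := below_ex x; exists (iota 0 k) => n.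
  rewrite mem_iota /= add0n -leqNgt => kn.
  by apply/tr_eq0/(below_le kn).
pose F x : dsum M := exist (fun y : dprod M => y \in @finsupp_pred A nat M) _ (fin x).
have FD (x y : sfmod T) : F (x + y) = F x + F y.
  by apply: dsum_ext => n; apply: trD.
have FZ (a : A) (x : sfmod T) : F (a *: x) = a *: F x.
  by apply: dsum_ext => n; apply: trZ.
have FG m (x : sfmod T) : homog (gmg (sfmod T)) m x -> homog (gmg (dsum M)) m (F x).
  by move=> hx; apply/dsum_homogP => n; apply: (@tr_homog _ (sfg T)).
have Fd (x : sfmod T) : F (dgmd (sfmod T) x) = dgmd (dsum M) (F x).
  by apply: dsum_ext => n; apply: tr_dT; apply: sfb_below.
pose Fh := @build_dgmod_hom A (sfmod T) (dsum M) F FD FZ FG Fd.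
move=> /(_ nat M)[/(_ (@Roof A X (dsum M) (sfmod T) q Fh qq))].
move=> [s [phi [[us _] [Z [t [u [v [tq /= tu _ nu]]]]]]]] _.
pose n := (\max_(i <- s) i).+1.
have ns : n \notin s.
  apply/negP => si; have := leq_bigmax_seq (P := xpredT) (F := fun j => j) n si isT.
  by rewrite ltnn.
have un : homotopic (trhom T n \o u) (fun=> 0).
  have := homotopic_post (dproj M n) nu.
  rewrite [X in homotopic _ X](_ : _ = (fun=> 0)) //.
  apply/funext => z /=; rewrite (dval_sum_in (fun i => roof_num (phi i) (v i z))) //.
  by rewrite (negbTE ns).
have [r rt] := sf_lift tq q.
have ur : homotopic (dgmod_comp u r) id.
  apply: (sf_lift_unique qq (f' := dgmod_idhom _)).
  apply: homotopic_trans rt.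
  exact/homotopic_sym/(homotopic_pre r tu).
apply: (@null_bounded _ _ n).
apply: homotopic_trans (homotopic_pre r un).
exact: (homotopic_post (trhom T n) (homotopic_sym ur)).
Qed.

Lemma bounded_compact : sf_bounded T -> compact_object X.
Proof.
move=> /bounded_retract[n [r [rid rn]]] I M; split.
  move=> [Z0 den num denq]; have [l lq] := sf_lift denq q.
  pose f := dgmod_comp num l.
  pose s := undup (flatten [seq s2val (cid2 (dval_fin (f (ebas A j)))) | j <- iota 0 n]).
  have fs x i : below n x -> i \notin s -> dval (f x) i = 0.
    move=> nx ins; rewrite (fs_sum nx) (big_morph _ (ghD f) (gh0 f)) dval_sum.
    rewrite big1 // => j _; rewrite ghZ dvalZ.
    rewrite (s2valP' (cid2 (dval_fin (f (ebas A j))))) ?scaler0 //.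
    apply: contra ins => ij; rewrite mem_undup; apply/flatten_mapP.
    by exists (val j) => //; rewrite mem_iota /= add0n.
  pose fi i := dgmod_comp (dproj M i) (dgmod_comp f r).
  exists s, (fun i => @Roof A X (M i) (sfmod T) q (fi i) qq); split.
    split=> [|i si]; first exact: undup_uniq.
    exists (sfmod T), q, (dgmod_idhom _); split=> //=; first exact: homotopic_refl.
    rewrite (_ : _ \o _ = fun=> 0); first exact: homotopic_refl.
    by apply/funext => x; apply: fs.
  exists (sfmod T), q, l, (fun=> dgmod_idhom _); split=> //=.
  - exact: homotopic_sym.
  - by move=> i _; apply: homotopic_refl.
  rewrite (_ : (fun z => _) = f \o r).
    exact: (homotopic_post f rid).
  apply/funext => x; apply: dsum_ext => i.
  rewrite (dval_sum_in (fun i => fi i x)) ?undup_uniq //.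
  by case: ifP => //= /negbT /fs ->.
move=> Phi s s' phi phi' [us nphi] [us' nphi'].
move=> [Z [t [u [v [tq tu tv nu]]]]] [Z' [t' [u' [v' [tq' tu' tv' nu']]]]] i.
have part s0 phi0 Z0 (t0 : dgmod_hom Z0 X) (u0 : dgmod_hom Z0 (roof_apex Phi))
    (v0 : forall i, dgmod_hom Z0 (roof_apex (phi0 i))) (r0 : dgmod_hom (sfmod T) Z0) :
    uniq s0 -> (forall i, i \notin s0 -> roof_null (phi0 i)) ->
    (forall i, i \in s0 -> homotopic t0 (roof_den (phi0 i) \o v0 i)) ->
    homotopic (roof_num Phi \o u0)
      (fun z => \sum_(i <- s0) dsum_in (roof_num (phi0 i) (v0 i z)) : dsum M) ->
    homotopic (t0 \o r0) q ->
    exists w : dgmod_hom (sfmod T) (roof_apex (phi0 i)),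
      homotopic q (roof_den (phi0 i) \o w) /\
      homotopic (roof_num (phi0 i) \o w) (dproj M i \o roof_num Phi \o u0 \o r0).
  move=> us0 n0 t0v nu0 tr0.
  have {}nu0 := homotopic_pre r0 (homotopic_post (dproj M i) nu0).
  have sE z : dval (\sum_(i <- s0) dsum_in (roof_num (phi0 i) (v0 i z)) : dsum M) i
      = if i \in s0 then roof_num (phi0 i) (v0 i z) else 0.
    exact: (dval_sum_in (fun i => roof_num (phi0 i) (v0 i z))).
  have [si|si] := boolP (i \in s0).
    exists (dgmod_comp (v0 i) r0); split.
      apply: homotopic_trans (homotopic_sym tr0) _.
      exact: (homotopic_pre r0 (t0v _ si)).
    apply/homotopic_sym/(homotopic_trans nu0).
    rewrite [X in homotopic X](_ : _ = roof_num (phi0 i) \o v0 i \o r0).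
      exact: homotopic_refl.
    by apply/funext => z; rewrite /= sE si.
  have [Z1 [t1 [u1 [tq1 tu1 nu1]]]] := n0 _ si.
  have [r1 r1q] := sf_lift tq1 q.
  exists (dgmod_comp u1 r1); split.
    apply: homotopic_trans (homotopic_sym r1q) _.
    exact: (homotopic_pre r1 tu1).
  apply: homotopic_trans (homotopic_pre r1 nu1) _.
  apply/homotopic_sym/(homotopic_trans nu0).
  rewrite [X in homotopic X](_ : _ = (fun=> 0)); first exact: homotopic_refl.
  by apply/funext => z; rewrite /= sE (negbTE si).
have [l lq] := sf_lift tq q; have [l' lq'] := sf_lift tq' q.
have [w [wq wn]] := part _ _ _ _ _ _ l us nphi tv nu lq.
have [w' [wq' wn']] := part _ _ _ _ _ _ l' us' nphi' tv' nu' lq'.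
exists (sfmod T), q, w, w'; split=> //.
apply: homotopic_trans wn _; apply/homotopic_sym/(homotopic_trans wn').
have uu : homotopic (dgmod_comp u' l') (dgmod_comp u l).
  apply: (sf_lift_unique (roof_qis Phi)).
  apply: homotopic_trans (homotopic_sym (homotopic_pre l' tu')) _.
  apply: homotopic_trans lq' _.
  apply: homotopic_trans (homotopic_sym lq) _.
  exact: (homotopic_pre l tu).
exact: (homotopic_post (dgmod_comp (dproj M i) (roof_num Phi)) uu).
Qed.

End Compact.

(** * Base change *)

Definition rmod (B C : dga) (f : dga_hom B C) (N : dgmod C) : Type := N.

Section RestrictionOfScalars.
Variables (B C : dga) (f : dga_hom B C) (N : dgmod C).

HB.instance Definition _ := GRing.Zmodule.on (rmod f N).

Definition rmod_scale (a : B) (x : rmod f N) : rmod f N := f a *: (x : N).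

Lemma rmod_scaleA a b x : rmod_scale a (rmod_scale b x) = rmod_scale (a * b) x.
Proof. by rewrite /rmod_scale rmorphM scalerA. Qed.

Lemma rmod_scale1 : left_id 1 rmod_scale.
Proof. by move=> x; rewrite /rmod_scale rmorph1 scale1r. Qed.

Lemma rmod_scaleDr : right_distributive rmod_scale +%R.
Proof. by move=> a x y; apply: scalerDr. Qed.

Lemma rmod_scaleDl x : {morph rmod_scale^~ x : a b / a + b}.
Proof. by move=> a b; rewrite /rmod_scale rmorphD scalerDl. Qed.

HB.instance Definition _ := GRing.Zmodule_isLmodule.Build B (rmod f N)
  rmod_scaleA rmod_scale1 rmod_scaleDr rmod_scaleDl.

Lemma rmod_homogZ m n (a : B) (x : rmod f N) : homog (grg B) m a ->
  homog (gmg N) n x -> homog (gmg N) (m + n) (a *: x).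
Proof. by move=> /(gring_fun_homog f) ha hx; apply: homogZ. Qed.

Definition rgmod : gmod B := @GMod B (rmod f N) (gmg N) rmod_homogZ.

Lemma rmod_leibniz n (a : B) (x : rgmod) : homog (grg B) n a ->
  dgmd N (a *: x) = dgad B a *: x + ksign B n *: (a *: (dgmd N x : rgmod)).
Proof.
move=> /(gring_fun_homog f) ha.
rewrite [LHS](dgmod_leibniz _ ha) -dga_fun_d; congr (_ + _).
by rewrite /GRing.scale /= /rmod_scale /ksign rmorphXn rmorphN1.
Qed.

Definition rdgmod : dgmod B := @DGMod B rgmod (dgmd N) rmod_leibniz.

End RestrictionOfScalars.

Section BaseChange.
Variables (B C : dga) (f : dga_hom B C).

Lemma push_subproof (x : fsmod B) i :
  (sval (cid (below_ex x)) <= i)%N -> f (coef x i) = 0.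
Proof. by move=> /(svalP (cid (below_ex x))) ->; rewrite rmorph0. Qed.

Definition push (x : fsmod B) : fsmod C := fsfun (@push_subproof x).

Lemma coef_push x i : coef (push x) i = f (coef x i). Proof. by []. Qed.

Lemma pushD x y : push (x + y) = push x + push y.
Proof. by apply: coef_ext => i; rewrite coefD !coef_push coefD rmorphD. Qed.

Lemma pushB x y : push (x - y) = push x - push y.
Proof. by apply: coef_ext => i; rewrite coefB !coef_push coefB rmorphB. Qed.

Lemma push0 : push 0 = 0. Proof. exact: subr_morph0 pushB. Qed.

Lemma pushZ (a : B) x : push (a *: x) = f a *: push x.
Proof. by apply: coef_ext => i; rewrite coefZ !coef_push coefZ rmorphM. Qed.

Lemma push_below n x : below n x -> below n (push x).
Proof. by move=> nx i /nx xi; rewrite coef_push xi rmorph0. Qed.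

Lemma push_ebas j : push (ebas B j) = ebas C j.
Proof.
by apply: coef_ext => i; rewrite coef_push !coef_ebas; case: eqP; rewrite ?rmorph1 ?rmorph0.
Qed.

Lemma push_homog g n x : homog (fsgrading B g) n x -> homog (fsgrading C g) n (push x).
Proof. by move=> /fs_homogP hx; apply/fs_homogP => i; apply: gring_fun_homog. Qed.

Lemma push_tr n x : push (tr n x) = tr n (push x).
Proof.
by apply: coef_ext => i; rewrite coef_push !coef_tr coef_push; case: ifP; rewrite ?rmorph0.
Qed.

Lemma push_slin w x : push (slin w x) = slin (push \o w) (push x).
Proof.
elim/fs_ind: x => [|x y hx hy|a j]; first by rewrite slin0 push0 slin0.
- by rewrite slinD !pushD slinD hx hy.
by rewrite slinZ !pushZ push_ebas slinZ !slin_ebas sgn_hom.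
Qed.

Lemma push_dT b x : push (dT b x) = dT (push \o b) (push x).
Proof.
rewrite /dT pushD push_slin; congr (_ + _).
by apply: coef_ext => i; rewrite coef_push !coef_cmap coef_push dga_fun_d.
Qed.

Section PushSemifree.
Variable T : semifree B.

Lemma sfpush_below j : below j (push (sfb T j)).
Proof. exact/push_below/sfb_below. Qed.

Lemma sfpush_homog j : homog (fsgrading C (sfg T)) (sfg T j - 1) (push (sfb T j)).
Proof. exact/push_homog/sfb_homog. Qed.

Lemma sfpush_cycle j : dT (push \o sfb T) (push (sfb T j)) = 0.
Proof. by rewrite -push_dT sfb_cycle push0. Qed.

Definition sfpush : semifree C := Semifree sfpush_below sfpush_homog sfpush_cycle.

Definition pushhom : dgmod_hom (sfmod T) (rdgmod f (sfmod sfpush)) :=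
  @build_dgmod_hom B (sfmod T) (rdgmod f (sfmod sfpush)) push pushD pushZ
    (@push_homog (sfg T)) (push_dT (sfb T)).

Hypothesis fq : dga_quasi_iso f.

Lemma push_cone n x y : below n x -> below n y -> dT (sfb T) x = 0 ->
  push x = dT (sfb sfpush) y ->
  exists m k, dT (sfb T) m = x /\ push m = y + dT (sfb sfpush) k.
Proof.
have [fc _] := quasi_isoP (dV := dgad B) (dW := dgad C) (rmorphB f) (dga_fun_d f).
have {fc}cone := fc fq.
have bB := @sfb_below B T; have bC := @sfb_below C sfpush.
elim: n x y => [|n IH] x y nx ny dx px.
  by exists 0, 0; rewrite !dT0 push0 addr0 !(below0_eq0 nx) !(below0_eq0 ny).
have dxn : dgad B (coef x n) = 0.
  by rewrite -(dT_top (b := sfb T) (fun i _ => bB i) nx) dx.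
have pxn : f (coef x n) = dgad C (coef y n).
  by rewrite -(dT_top (b := sfb sfpush) (fun i _ => bC i) ny) -px.
have [a [c [da fa]]] := cone _ _ dxn pxn.
pose x' := x - dT (sfb T) (a *: ebas B n).
pose y' := y - push (a *: ebas B n) + dT (sfb sfpush) (c *: ebas C n).
have nB (r : B) : below n.+1 (r *: ebas B n) by apply/belowZ/below_ebas.
have nC (r : C) : below n.+1 (r *: ebas C n) by apply/belowZ/below_ebas.
have coefn (D : dga) (r : D) : coef (r *: ebas D n) n = r.
  by rewrite coefZ coef_ebas eqxx mulr1.
have dB (r : B) : below n.+1 (dT (sfb T) (r *: ebas B n)) by apply: dT_below.
have dC (r : C) : below n.+1 (dT (sfb sfpush) (r *: ebas C n)) by apply: dT_below.
have top (D : dga) (z : fsmod D) : below n.+1 z -> coef z n = 0 -> below n z.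
  move=> nz zn i; rewrite leq_eqVlt => /orP[/eqP<-//|].
  exact: nz.
have nx' : below n x'.
  apply: top; first exact: belowB.
  by rewrite coefB (dT_top (fun i _ => bB i)) // coefn da subrr.
have ny' : below n y'.
  apply: top; first by apply: belowD (dC c); apply: belowB ny _; apply: push_below.
  by rewrite coefD coefB coef_push (dT_top (fun i _ => bC i)) // !coefn fa opprD addrA subrr sub0r addNr.
have dx' : dT (sfb T) x' = 0 by rewrite dTB dx sf_dK subr0.
have px' : push x' = dT (sfb sfpush) y'.
  by rewrite dTD dTB sf_dK addr0 pushB px push_dT.
have [m [k [dm pm]]] := IH x' y' nx' ny' dx' px'.
exists (m + a *: ebas B n), (c *: ebas C n + k); split.
  by rewrite dTD dm subrK.
by rewrite pushD pm dTD addrAC /y' [X in X + _]addrAC subrK -addrA.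
Qed.

Lemma push_qis : dgmod_quasi_iso pushhom.
Proof.
apply/(quasi_isoP (dV := dgmd (sfmod T)) (dW := dgmd (sfmod sfpush)) pushB (push_dT (sfb T))).
move=> x y dx px; have [m mx] := below_ex x; have [n ny] := below_ex y.
apply: (@push_cone (maxn m n)) => //.
  by apply: below_le mx; apply: leq_maxl.
by apply: below_le ny; apply: leq_maxr.
Qed.

End PushSemifree.

Lemma push_bounded T : sf_bounded T -> sf_bounded (sfpush T).
Proof.
move=> [n [w [wh wn]]]; exists n, (push \o w); split=> j.
  exact: (push_homog (wh j)).
have := push_below (wn j).
by rewrite !pushB push_ebas push_dT push_slin.
Qed.

Lemma bounded_push T : dga_quasi_iso f -> sf_bounded (sfpush T) -> sf_bounded T.
Proof.
move=> fq [n [w [wh wn]]]; apply: (@null_bounded _ _ n).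
apply: (sf_lift_unique (push_qis (sftr T n) fq) (f := trhom T n)
  (f' := dgmod_zero (sfmod T) (sfmod (sftr T n)))).
pose N := rdgmod f (sfmod (sfpush (sftr T n))).
apply: (@sf_homotopic_ex B T N
  (dgmod_comp (pushhom (sftr T n)) (trhom T n))
  (dgmod_comp (pushhom (sftr T n)) (dgmod_zero _ _)) (fun j => tr n (w j))).
  by move=> j; apply: (tr_homog n (wh j)).
move=> j; rewrite /= push0 subr0.
have -> : slin (fun j => tr n (w j) : N) (sfb T j) = tr n (slin w (push (sfb T j))) :> fsmod C.
  apply/esym; apply: (@slinP B N _ (fun x => tr n (slin w (push x)))).
  - by move=> x y; rewrite pushD slinD trD.
  - by move=> a x; rewrite pushZ slinZ trZ -sgn_hom.
  - by move=> i; rewrite push_ebas slin_ebas.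
rewrite push_tr push_ebas.
have /tr_eq0 := wn j; rewrite !trB tr_dT; last exact: sfb_below.
move=> /eqP; rewrite subr_eq0 subr_eq => /eqP ->; rewrite addrC; congr (_ + _).
by apply: dT_congr (tr_below n _) => [i _|]; [rewrite /= push_tr|apply: (svalP (cid (below_ex (w j))))].
Qed.

End BaseChange.

(** * Noetherian homology *)

Section CycleIdeals.
Variable B : dga.
Notation d := (dgad B).

Definition cycle_ideal (J : set B) : Prop :=
  [/\ (forall y, J (d y)), (forall x y, J x -> J y -> J (x + y))
    & (forall c x, d c = 0 -> J x -> J (c * x))].

(* Every graded left ideal of the homology is finitely generated; ideals are *)
(* represented by their preimages in the cycles.                             *)
Definition noetherian_homology : Prop := forall J : set B, cycle_ideal J ->
  (forall x, J x -> d x = 0) -> (forall n x, J x -> J (grg B n x)) ->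
  exists s : seq B, (forall a, a \in s -> J a /\ exists r, homog (grg B) r a) /\
    forall U : set B, cycle_ideal U -> (forall a, a \in s -> U a) -> J `<=` U.

End CycleIdeals.

Lemma seq_ex (S : eqType) (T : eqType) (s : seq S) (R : S -> T -> Prop) :
  (forall a, a \in s -> exists b, R a b) ->
  exists t : seq T, (forall b, b \in t -> exists2 a, a \in s & R a b) /\
    (forall a, a \in s -> exists2 b, b \in t & R a b).
Proof.
elim: s => [_|a s IH H]; first by exists [::].
have [|t [t1 t2]] := IH; first by move=> x xs; apply: H; rewrite inE xs orbT.
have [b ab] := H a (mem_head _ _).
exists (b :: t); split=> x; rewrite inE => /orP[/eqP->|].
- by exists a => //; apply: mem_head.
- by move=> /t1[y ys xy]; exists y => //; rewrite inE ys orbT.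
- by exists b => //; apply: mem_head.
- by move=> /t2[y ys xy]; exists y => //; rewrite inE ys orbT.
Qed.

Section NoetherianTransfer.
Variables (B C : dga) (f : dga_hom B C).
Hypothesis fq : dga_quasi_iso f.

Lemma noetherian_push : noetherian_homology B -> noetherian_homology C.
Proof.
move=> nB J [Jd JD JM] Jc JG; have [finj fsur] := fq.
have [|x [] //|n x [dx Jx]|s [s1 s2]] := nB [set x | dgad B x = 0 /\ J (f x)].
- split=> [y|x y [dx Jx] [dy Jy]|c x dc [dx Jx]] /=.
  + by rewrite diffK dga_fun_d; split.
  + by rewrite diffD dx dy addr0 rmorphD; split=> //; apply: JD.
  + rewrite dga_cycleM // rmorphM; split=> //; apply: JM => //.
    by rewrite -dga_fun_d dc rmorph0.
- by rewrite /= diff_pr dx gpr0 gring_fun_pr; split=> //; apply: JG.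
exists [seq f x | x <- s]; split.
  move=> _ /mapP[x /s1[[_ Jx] [r rx]] ->]; split=> //.
  by exists r; apply: gring_fun_homog.
move=> U [Ud UD UM] sU y Jy; have [x [dx [z yE]]] := fsur _ (Jc _ Jy).
have Jfx : J (f x).
  have -> : f x = y + dgad C (- z) by rewrite yE diffN addrK.
  exact: JD.
have : [set x | dgad B x = 0 /\ U (f x)] x.
  apply: s2; last by split.
    split=> [u|u v [du Uu] [dv Uv]|c u dc [du Uu]] /=.
    + by rewrite diffK dga_fun_d; split.
    + by rewrite diffD du dv addr0 rmorphD; split=> //; apply: UD.
    + rewrite dga_cycleM // rmorphM; split=> //; apply: UM => //.
      by rewrite -dga_fun_d dc rmorph0.
  by move=> a sa; split; [case: (s1 _ sa) => [[]]|apply/sU/map_f].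
by move=> [_ Ux]; rewrite yE; apply: UD.
Qed.

Lemma noetherian_pull : noetherian_homology C -> noetherian_homology B.
Proof.
move=> nC J [Jd JD JM] Jc JG; have [finj fsur] := fq.
have ext (K : set B) : cycle_ideal K -> (forall x, K x -> dgad B x = 0) ->
    cycle_ideal [set y | exists x z, K x /\ y = f x + dgad C z].
  move=> [Kd KD KM] Kc; split=> [y|x y [u [z [Ku ->]]] [v [t [Kv ->]]]|c y dc [u [z [Ku ->]]]].
  - by exists 0, y; rewrite rmorph0 add0r -(diff0 (dgad B)).
  - exists (u + v), (z + t); split; first exact: KD.
    by rewrite rmorphD diffD addrACA.
  - have [c' [dc' [w ->]]] := fsur _ dc.
    have [z1 z1E] := dga_boundMl z dc; have [|w1 w1E] := dga_boundMr w (y := f u).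
      by rewrite -dga_fun_d Kc // rmorph0.
    have [|z2 z2E] := dga_boundMl z (x := f c' + dgad C w).
      by rewrite diffD diffK addr0 -dga_fun_d dc' rmorph0.
    exists (c' * u), (w1 + z2); split; first exact: KM.
    by rewrite mulrDr z2E mulrDl w1E rmorphM diffD addrA.
have [|y [x [z [Jx ->]]]|n y [x [z [Jx ->]]]|s [s1 s2]] :=
  nC [set y | exists x z, J x /\ y = f x + dgad C z].
- by apply: ext => //; split.
- by rewrite diffD diffK addr0 -dga_fun_d Jc // rmorph0.
- exists (grg B n x), (grg C (n + 1) z); split; first exact: JG.
  by rewrite gprD gring_fun_pr diff_pr addrK.
have [y /s1[[x [z [Jx yE]]] [r ry]]|t [t1 t2]] :=
  @seq_ex C B s (fun y x => [/\ J x, (exists r, homog (grg B) r x)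
    & exists z, y = f x + dgad C z]).
  exists (grg B r x); split; first exact: JG.
    by exists r; apply: homog_gpr.
  exists (grg C (r + 1) z).
  by rewrite gring_fun_pr -[X in grg C X (f x)](addrK 1) -[X in X + dgad C _]/(grg C _ _) diff_pr addrK -gprD -yE ry.
exists t; split=> [x /t1[_ _ []]//|U [Ud UD UM] tU x Jx].
have dU : cycle_ideal [set x | J x /\ U x].
  split=> [y|u v [Ju Uu] [Jv Uv]|c u dc [Ju Uu]] /=; split=> //.
  - exact: JD.
  - exact: UD.
  - exact: JM.
  - exact: UM.
have [] := s2 [set y | exists x z, (J x /\ U x) /\ y = f x + dgad C z] _ _ (f x).
- by apply: ext => // u [/Jc].
- move=> y sy; have [u tu [Ju _ [z ->]]] := t2 _ sy.
  by exists u, z; split=> //; split=> //; apply: tU.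
- by exists x, 0; rewrite diff0 addr0.
move=> u [z [[Ju Uu] fx]].
have [||y xuE] := finj (x - u).
- by rewrite diffB !Jc ?subrr.
- by exists z; rewrite rmorphB fx addrC addKr.
by rewrite -(subrK u x) xuE addrC; apply: UD.
Qed.

End NoetherianTransfer.

Lemma noetherian_zero_diff (R : gring) : graded_commutative R ->
  graded_noetherian R -> noetherian_homology (dga_of_gring R).
Proof.
move=> Rc Rn J [Jd JD JM] _ JG.
have J0 : J 0 by apply: (Jd 0).
have Jsum (r : seq int) (F : int -> R) : (forall i, J (F i)) -> J (\sum_(i <- r) F i).
  by move=> JF; apply: (big_ind J) => //.
have iJ : graded_ideal (J : set R).
  split=> // a x Jx; split; first exact: JM.
  have [s _ ->] := gpr_fin (grg R) x; have [t _ ->] := gpr_fin (grg R) a.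
  rewrite mulr_suml; apply: (Jsum) => m; rewrite mulr_sumr; apply: Jsum => n.
  rewrite (Rc _ _ _ _ (homog_gpr _ m x) (homog_gpr _ n a)).
  by apply: (JM) => //; apply: (JM) => //; apply: JG.
have [s sE] := Rn _ iJ.
have Js a : a \in s -> J a.
  move=> sa; rewrite sE /=; exists (fun i => if i == index a s :> nat then 1 else 0).
  have ia : (index a s < size s)%N by rewrite index_mem.
  rewrite (bigD1 (Ordinal ia)) //= eqxx mul1r nth_index // big1 ?addr0 // => i /eqP ii.
  case: eqP => [iE|]; last by rewrite mul0r.
  by case: ii; apply: val_inj.
exists (flatten [seq [seq grg R n a | n <- s2val (cid2 (gpr_fin (grg R) a))] | a <- s]).
split=> [x /flatten_mapP[a sa /mapP[n _ ->]]|U [Ud UD UM] sU x].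
  by split; [apply/JG/Js|exists n; apply: homog_gpr].
have U0 : U 0 by apply: (Ud 0).
rewrite sE => -[c ->]; apply: (big_ind U) => // i _; apply: UM => //.
rewrite (s2valP' (cid2 (gpr_fin (grg R) s`_i))) big_seq.
apply: (big_ind U) => // n ns; apply: sU; apply/flatten_mapP; exists s`_i.
  exact: mem_nth.
exact: map_f.
Qed.

(** * Semi-free resolutions with finite stages *)

Section Weights.
Variable B : dga.
Notation V := (fsmod B).

Lemma weight_subproof (w : nat -> nat) n i : (if w i == n then 0 else 0) = 0 :> B.
Proof. by case: ifP. Qed.

Definition wt (w : nat -> nat) (n : nat) : V -> V :=
  cmap (fun i a => if w i == n then a else 0) (weight_subproof w n).

Lemma coef_wt w n x i : coef (wt w n x) i = if w i == n then coef x i else 0.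
Proof. by []. Qed.

Definition pure (w : nat -> nat) (n : nat) (x : V) : Prop :=
  forall i, w i != n -> coef x i = 0.

Lemma wtD w n x y : wt w n (x + y) = wt w n x + wt w n y.
Proof. by apply: coef_ext => i; rewrite coefD !coef_wt; case: eqP; rewrite ?addr0. Qed.

Lemma wtZ w n (a : B) x : wt w n (a *: x) = a *: wt w n x.
Proof. by apply: coef_ext => i; rewrite coefZ !coef_wt; case: eqP; rewrite ?mulr0. Qed.

Lemma wtB w n x y : wt w n (x - y) = wt w n x - wt w n y.
Proof. by rewrite wtD -scaleN1r wtZ scaleN1r. Qed.

Lemma wt0 w n : wt w n 0 = 0.
Proof. exact: subr_morph0 (wtB w n). Qed.

Lemma wt_ebas w n j : wt w n (ebas B j) = if w j == n then ebas B j else 0.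
Proof.
apply: coef_ext => i; rewrite coef_wt !coef_ebas.
case: (eqVneq i j) => [->|ij]; last by case: eqP => _; case: eqP; rewrite // coef_ebas (negbTE ij).
by case: eqP => _; rewrite ?coef_ebas ?eqxx.
Qed.

Lemma wt_below w n m x : below m x -> below m (wt w n x).
Proof. exact: cmap_below. Qed.

Lemma wt_pure w n x : pure w n (wt w n x).
Proof. by move=> i wi; rewrite coef_wt (negbTE wi). Qed.

Lemma pure_wt w n x : pure w n x -> wt w n x = x.
Proof. by move=> px; apply: coef_ext => i; rewrite coef_wt; case: eqP => // /eqP/px. Qed.

Lemma wt_homog w g n m x :
  homog (fsgrading B g) m x -> homog (fsgrading B g) m (wt w n x).
Proof.
move=> /fs_homogP hx; apply/fs_homogP => i; rewrite coef_wt.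
by case: ifP => _; [apply: hx|apply: homog0].
Qed.

Lemma wt_sum w n K x : below n x -> (forall i, (i < n)%N -> (w i < K)%N) ->
  x = \sum_(k <- iota 0 K) wt w k x.
Proof.
move=> nx wK; apply: coef_ext => i; rewrite coef_sum.
under eq_bigr do rewrite coef_wt.
have [ni|ni] := leqP n i.
  by rewrite nx // big1 // => k _; case: ifP.
rewrite (bigD1_seq (w i)) ?iota_uniq ?mem_iota //=; last by rewrite add0n wK.
by rewrite eqxx big1 ?addr0 // => k; rewrite eq_sym => /negbTE ->.
Qed.

Definition weighted (b : nat -> V) (w : nat -> nat) : Prop :=
  forall j i, coef (b j) i != 0 -> w j = (w i).+1.

Hypothesis d0 : forall x, dgad B x = 0.

Lemma dT_wt b w n x : weighted b w -> dT b (wt w n.+1 x) = wt w n (dT b x).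
Proof.
move=> wb; elim/fs_ind: x => [|x y hx hy|a j]; first by rewrite dT0 !wt0 dT0.
- by rewrite wtD !dTD wtD hx hy.
rewrite wtZ !dTZ !d0 !scale0r !add0r wtZ wt_ebas dT_ebas; congr (_ *: _).
have bij i : w j <> (w i).+1 -> coef (b j) i = 0.
  by move=> ji; apply/eqP/negPn/negP => /wb.
case: eqP => wj; rewrite ?dT0 ?dT_ebas; apply: coef_ext => i; rewrite coef_wt.
  by case: eqP => // wi; apply: bij; rewrite wj; lia.
by case: eqP => // wi; rewrite bij // wi.
Qed.

Lemma dT_wt0 b w x : weighted b w -> dT b (wt w 0 x) = 0.
Proof.
move=> wb; elim/fs_ind: x => [|x y hx hy|a j]; first by rewrite wt0 dT0.
- by rewrite wtD dTD hx hy addr0.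
rewrite wtZ dTZ d0 scale0r add0r wt_ebas; case: eqP => wj; last by rewrite dT0 scaler0.
rewrite dT_ebas (_ : b j = 0) ?scaler0 //; apply: coef_ext => i.
by apply/eqP/negPn/negP => /wb; rewrite wj.
Qed.

End Weights.

Section Stages.
Variables (B : dga) (k : gring) (eps : dga_hom B (dga_of_gring k)).
Notation V := (fsmod B).
Implicit Types (g : nat -> int) (b : nat -> V) (w : nat -> nat).

(* The augmentation of the resolution sends e_0 to 1 and the other e_j to 0, *)
(* so that its value at x is [eps (coef x 0)].                               *)
Definition rcycle b n (x : V) : Prop :=
  [/\ below n x, dT b x = 0 & eps (coef x 0) = 0].

Definition stage_ideal b n (U : set V) : Prop :=
  [/\ (forall y, below n y -> U (dT b y)), (forall x y, U x -> U y -> U (x + y))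
    & (forall (c : B) x, dgad B c = 0 -> U x -> U (c *: x))].

Lemma eps_d x : eps (dgad B x) = 0.
Proof. by rewrite dga_fun_d. Qed.

Lemma eps_dT b x : (forall j, eps (coef (b j) 0) = 0) -> eps (coef (dT b x) 0) = 0.
Proof.
move=> eb; rewrite coefD coef_cmap rmorphD eps_d add0r.
have [n nx] := below_ex x; rewrite /slin (linE _ (vsgn_below nx)) coef_sum rmorph_sum.
by rewrite big1 // => j _; rewrite coefZ rmorphM eb mulr0.
Qed.

Lemma stage_ideal_rcycle b n : (forall j, below j (b j)) -> (forall x, dT b (dT b x) = 0) ->
  (forall j, eps (coef (b j) 0) = 0) -> stage_ideal b n (rcycle b n).
Proof.
move=> bB bK eb; split=> [y ny|x y [nx dx ex] [ny dy ey]|c x dc [nx dx ex]].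
- by split; [apply: dT_below|apply: bK|apply: eps_dT].
- split; first exact: belowD.
  + by rewrite dTD dx dy addr0.
  + by rewrite coefD rmorphD ex ey addr0.
- split; first exact: belowZ.
  + by rewrite dTZ dc dx scale0r scaler0 addr0.
  + by rewrite coefZ rmorphM ex mulr0.
Qed.

Hypothesis nB : noetherian_homology B.

(* Induction on n: the coefficients at e_n of the elements of [rcycle n.+1]   *)
(* form an ideal of the homology.                                            *)
Lemma rcycle_fg (T : semifree B) n : (forall j, eps (coef (sfb T j) 0) = 0) ->
  exists L : seq (int * V),
    (forall t, t \in L -> rcycle (sfb T) n t.2 /\ homog (fsgrading B (sfg T)) t.1 t.2) /\
    forall U, stage_ideal (sfb T) n U -> (forall t, t \in L -> U t.2) ->
      rcycle (sfb T) n `<=` U.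
Proof.
move=> eb; set b := sfb T; set g := sfg T.
have bB j : below j (b j) by apply: sfb_below.
have rI m : stage_ideal b m (rcycle b m).
  by apply: stage_ideal_rcycle => // x; apply: sf_dK.
elim: n => [|n [L [L1 L2]]].
  exists [::]; split=> // U [Ud _ _] _ x [/below0_eq0 -> _ _].
  by rewrite -(dT0 b); apply: Ud.
have [rd rD rM] := rI n.+1.
have nebas (a : B) : below n.+1 (a *: ebas B n) by apply/belowZ/below_ebas.
have coefn (a : B) : coef (a *: ebas B n) n = a by rewrite coefZ coef_ebas eqxx mulr1.
pose J := [set a : B | exists2 z, rcycle b n.+1 z & coef z n = a].
have [||m a [z [nz dz ez] <-]|s [s1 s2]] := nB (J := J).
- split=> [y|_ _ [z rz <-] [z' rz' <-]|c _ dc [z rz <-]].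
  + exists (dT b (y *: ebas B n)); first by apply: rd.
    by rewrite dT_top // coefn.
  + by exists (z + z'); first exact: rD.
  + by exists (c *: z); first exact: rM.
- by move=> _ [z [nz dz _] <-]; rewrite -(dT_top (b := b) _ nz) // dz.
- exists (gr g (m + g n) z); last by rewrite coef_gr addrK.
  split; first exact: gr_below.
  + by rewrite sf_dgr dz gr0.
  + by rewrite coef_gr gring_fun_pr ez gpr0.
have [a /s1[[z [nz dz ez] za] [r ra]]|t [t1 t2]] :=
    @seq_ex B (int * V)%type s (fun a t => [/\ rcycle b n.+1 t.2,
      homog (fsgrading B g) t.1 t.2 & coef t.2 n = a]).
  exists (r + g n, gr g (r + g n) z); split=> /=; last by rewrite coef_gr addrK za.
    split; first exact: gr_below.
      by rewrite sf_dgr dz gr0.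
    by rewrite coef_gr gring_fun_pr ez gpr0.
  exact: (homog_gpr (fsgrading B g)).
exists (L ++ t); split=> [x|U [Ud UD UM] sU z rz].
  rewrite mem_cat => /orP[/L1[[nx dx ex] hx]|/t1[_ _ []]//].
  by split=> //; split=> //; apply: below_le nx.
have : [set a : B | exists2 z', rcycle b n.+1 z' /\ U z' & coef z' n = a] (coef z n).
  apply: s2; last by exists z.
    split=> [y|_ _ [u [ru Uu] <-] [v [rv Uv] <-]|c _ dc [u [ru Uu] <-]].
    - exists (dT b (y *: ebas B n)); first by split; [apply: rd|apply: Ud].
      by rewrite dT_top // coefn.
    - by exists (u + v) => //; split; [apply: rD|apply: UD].
    - by exists (c *: u) => //; split; [apply: rM|apply: UM].
  move=> a /t2[u ut [ru _ ua]]; exists u.2 => //; split=> //.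
  by apply: sU; rewrite mem_cat ut orbT.
move=> [u [ru Uu] uz]; rewrite -(subrK u z); apply: (UD) => //.
have zu : rcycle b n.+1 (z - u).
  by rewrite -scaleN1r; apply: rD => //; apply: rM => //; rewrite diffN dga_d1 oppr0.
apply: L2; last first.
  have [nzu dzu ezu] := zu; split=> // i; rewrite leq_eqVlt => /orP[/eqP<-|].
    by rewrite coefB uz subrr.
  exact: nzu.
- by move=> x Lx; apply: sU; rewrite mem_cat Lx.
split=> // y ny; apply: Ud; exact: below_le ny.
Qed.

Definition zero_d : Prop := forall x, dgad B x = 0.

Definition good g b w n (t : int * V * nat) : Prop :=
  [/\ rcycle b n t.1.2, homog (fsgrading B g) t.1.1 t.1.2
    & zero_d -> pure w t.2 t.1.2].

Definition stage g b w n (L : seq (int * V * nat)) : Prop :=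
  (forall t, t \in L -> good g b w n t) /\
  forall U, stage_ideal b n U -> (forall t, t \in L -> U t.1.2) -> rcycle b n `<=` U.

Lemma stage_ex (T : semifree B) w n : (forall j, eps (coef (sfb T j) 0) = 0) ->
  (zero_d -> weighted (sfb T) w) -> exists L, stage (sfg T) (sfb T) w n L.
Proof.
move=> eb wT; have [L [L1 L2]] := rcycle_fg n eb.
have [d0|nd0] := pselect zero_d; last first.
  exists [seq (t, 0%N) | t <- L]; split=> [_ /mapP[t /L1[rt ht] ->]|U iU LU].
    by split.
  by apply: L2 => // t Lt; apply: (LU (t, 0%N)); apply: map_f.
have {}wT := wT d0.
pose K := (\max_(i < n) w i).+1.
have wK i : (i < n)%N -> (w i < K)%N.
  by move=> lin; rewrite ltnS (leq_bigmax (F := fun i : 'I_n => w i) (Ordinal lin)).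
exists (flatten [seq [seq (t.1, wt w m t.2, m) | m <- iota 0 K] | t <- L]).
split=> [_ /flatten_mapP[t /L1[[nt dt et] ht] /mapP[m _ ->]]|U iU LU].
  split=> /=; last by move=> _; apply: wt_pure.
    split; first exact: wt_below.
      by case: m => [|m]; rewrite ?(dT_wt0 d0) ?(dT_wt d0) ?dt ?wt0.
    by rewrite coef_wt; case: ifP; rewrite ?rmorph0.
  exact: wt_homog.
apply: L2 => // t Lt; have [[nt _ _] _] := L1 t Lt; have [Ud UD _] := iU.
rewrite (wt_sum nt wK) big_seq; apply: (big_ind U) => //.
  by rewrite -(dT0 (sfb T)); apply: Ud.
move=> m mK; apply: (LU (t.1, wt w m t.2, m)).
by apply/flatten_mapP; exists t => //; apply: map_f.
Qed.

Section StageCongruence.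
Variables (g g' : nat -> int) (b b' : nat -> V) (w w' : nat -> nat) (n : nat).
Hypotheses (gg : forall i, (i < n)%N -> g i = g' i).
Hypotheses (bb : forall i, (i < n)%N -> b i = b' i).
Hypotheses (ww : forall i, (i < n)%N -> w i = w' i).

Lemma rcycle_congr x : rcycle b n x -> rcycle b' n x.
Proof. by move=> [nx dx ex]; split=> //; rewrite -(dT_congr bb). Qed.

Lemma good_congr t : good g b w n t -> good g' b' w' n t.
Proof.
move=> [rt ht pt]; split; first exact: rcycle_congr.
- have [nt _ _] := rt.
  by rewrite /homog /=; have := ht; rewrite /homog /= (gr_congr _ gg).
- move=> /pt {}pt i wi; have [nt _ _] := rt.
  have [/nt//|lin] := leqP n i.
  by apply: pt; rewrite ww.
Qed.

End StageCongruence.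

Lemma stage_congr g g' b b' w w' n L : (forall i, (i < n)%N -> g i = g' i) ->
  (forall i, (i < n)%N -> b i = b' i) -> (forall i, (i < n)%N -> w i = w' i) ->
  stage g b w n L -> stage g' b' w' n L.
Proof.
move=> gg bb ww [L1 L2]; split=> [t /L1|U [Ud UD UM] LU x rx].
  exact: good_congr.
apply: L2 => //.
  by split=> // y ny; rewrite (dT_congr bb) //; apply: Ud.
by apply: rcycle_congr rx => i /bb.
Qed.

Lemma good_le g b w m n t : (m <= n)%N -> good g b w m t -> good g b w n t.
Proof. by move=> mn [[nt dt et] ht pt]; split=> //; split=> //; apply: below_le nt. Qed.

Definition kills g b w j : Prop :=
  exists2 t, good g b w j t & [/\ g j = t.1.1 + 1, b j = t.1.2 & w j = t.2.+1].

Definition valid g b w j : Prop := b j = 0 \/ kills g b w j.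

Lemma valid_semifree g b w : (forall j, valid g b w j) ->
  exists T : semifree B, [/\ sfg T = g, sfb T = b,
    (forall j, eps (coef (b j) 0) = 0) & zero_d -> weighted b w].
Proof.
move=> vb.
have H j : [/\ below j (b j), homog (fsgrading B g) (g j - 1) (b j), dT b (b j) = 0
   & eps (coef (b j) 0) = 0].
  have [->|[t [[nt dt et] ht pt] [-> -> _]]] := vb j.
    split; [exact: below_0|exact: homog0|exact: dT0|exact: rmorph0].
  by split; rewrite ?addrK.
have H1 j : below j (b j) by case: (H j).
have H2 j : homog (fsgrading B g) (g j - 1) (b j) by case: (H j).
have H3 j : dT b (b j) = 0 by case: (H j).
exists (Semifree H1 H2 H3); split=> // [j|d0 j i]; first by case: (H j).
have [->|[t [_ _ pt] [_ -> wj]]] := vb j; first by rewrite coef0 eqxx.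
rewrite wj; case: (eqVneq (w i) t.2) => [->//|wi].
by rewrite (pt d0 _ wi) eqxx.
Qed.

Lemma valid_stage g b w n : (forall j, (j < n)%N -> valid g b w j) ->
  exists L, stage g b w n L.
Proof.
move=> vb.
pose g' i := if (i < n)%N then g i else 0.
pose b' i := if (i < n)%N then b i else 0.
pose w' i := if (i < n)%N then w i else 0%N.
have gE i : (i < n)%N -> g i = g' i by rewrite /g' => ->.
have bE i : (i < n)%N -> b i = b' i by rewrite /b' => ->.
have wE i : (i < n)%N -> w i = w' i by rewrite /w' => ->.
have [j|T [Tg Tb eb wb]] := @valid_semifree g' b' w'.
- have [jn|nj] := ltnP j n; last by left; rewrite /b' ltnNge nj.
  have [bj|[t tj [gj bj wj]]] := vb j jn; first by left; rewrite -bE.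
  right; exists t; last by rewrite -gE // -bE // -wE.
  by apply: good_congr tj => i ij; [apply: gE|apply: bE|apply: wE]; apply: ltn_trans jn.
rewrite -Tb in eb wb.
have [L LS] := stage_ex n eb wb; exists L; rewrite Tg Tb in LS.
by apply: stage_congr LS => i ij; rewrite -?gE -?bE -?wE.
Qed.

Lemma logn_lt j : (0 < j)%N -> (logn 2 j < j)%N.
Proof.
move=> j0; apply: leq_trans (ltn_expl (logn 2 j) (isT : (1 < 2)%N)) _.
by apply: dvdn_leq => //; apply: pfactor_dvdnn.
Qed.

Lemma logn23 n i : logn 2 (2 ^ n * 3 ^ i) = n /\ logn 3 (2 ^ n * 3 ^ i) = i.
Proof.
rewrite !lognM ?expn_gt0 // !lognX (_ : logn 2 2 = 1%N) // (_ : logn 2 3 = 0%N) //.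
by rewrite (_ : logn 3 2 = 0%N) // (_ : logn 3 3 = 1%N) // !muln1 !muln0 addn0.
Qed.

(* The i-th generator of the n-th stage is killed by e_j with j = 2^n 3^i.   *)
Lemma sf_resolution_ex : exists (T : semifree B) (w : nat -> nat),
  [/\ sfg T 0%N = 0 /\ sfb T 0%N = 0, w 0%N = 0%N,
      (forall j, eps (coef (sfb T j) 0) = 0),
      (forall n, exists n', forall x, rcycle (sfb T) n x ->
         exists2 y, below n' y & dT (sfb T) y = x)
    & zero_d -> weighted (sfb T) w].
Proof.
pose W := ((int * V * nat) * seq (int * V * nat))%type.
pose z : int * V * nat := (0, 0, 0%N).
pose G (v : nat -> W) i := (v i).1.1.1; pose D (v : nat -> W) i := (v i).1.1.2.
pose H (v : nat -> W) i := (v i).1.2.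
pose new (v : nat -> W) j : int * V * nat := if j is 0 then z else
  let t := nth z (v (logn 2 j)).2 (logn 3 j) in (t.1.1 + 1, t.1.2, t.2.+1).
pose Q j v (u : W) := stage (G v) (D v) (H v) j u.2 /\ u.1 = new v j.
have newE v v' j : (forall i, (i < j)%N -> v i = v' i) -> new v j = new v' j.
  by case: j => // j vv; rewrite /new vv // logn_lt.
have Qv j v : (forall i, (i < j)%N -> Q i v (v i)) -> Q j v (v j) -> 
    valid (G v) (D v) (H v) j.
  move=> Qi [_ vj]; case: j vj Qi => [|j] vj Qi; first by left; rewrite /D vj.
  right; set n := logn 2 j.+1; set i := logn 3 j.+1.
  have nj : (n < j.+1)%N by apply: logn_lt.
  exists (nth z (v n).2 i); last by rewrite /G /D /H vj.
  have [[gL _] _] := Qi n nj; have [iL|iL] := ltnP i (size (v n).2).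
    by apply: good_le (gL _ (mem_nth _ iL)); apply: ltnW.
  rewrite nth_default //; split; first by split; rewrite ?dT0 ?coef0 ?rmorph0.
    exact: homog0.
  by [].
have [|j v Qi|v vQ] := @seq_choice W (z, [::]) Q.
- move=> j v v' u vv [su uE]; split; last by rewrite uE; apply: newE.
  by apply: stage_congr su => i ij; rewrite /G /D /H vv.
- have [|L LS] := @valid_stage (G v) (D v) (H v) j.
    move=> i ij; apply: Qv (Qi i ij) => l li; apply: Qi; exact: ltn_trans ij.
  by exists (new v j, L).
have [j|T [Tg Tb eb wb]] := @valid_semifree (G v) (D v) (H v).
  by apply: Qv => [i _|]; apply: vQ.
exists T, (H v); rewrite Tg Tb; split=> //; first by rewrite /G /D (vQ 0%N).2.
  by rewrite /H (vQ 0%N).2.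
move=> n; have [[gL sL] _] := vQ n.
set L := (v n).2 in gL sL.
pose n' := (n + 2 ^ n * 3 ^ size L).+1; exists n'.
apply: (sL [set x | exists2 y, below n' y & dT (D v) y = x]).
  split=> [y ny|x y [x' nx <-] [y' ny <-]|c x dc [x' nx <-]].
  - by exists y => //; apply: below_le ny; rewrite /n'; lia.
  - by exists (x' + y'); [apply: belowD|rewrite dTD].
  - exists (sgn c *: x'); first exact: belowZ.
    have -> : dT (D v) (sgn c *: x') = - sgn (dgad B c) *: x' + c *: dT (D v) x'.
      by rewrite dTZ sgnK sgn_diff opprK.
    by rewrite dc sgn0 oppr0 scale0r add0r.
move=> t /(nthP z)[i iL ti].
pose j := (2 ^ n * 3 ^ i)%N; have j0 : (0 < j)%N by rewrite muln_gt0 !expn_gt0.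
exists (ebas B j).
  apply: below_le (@below_ebas B j); rewrite /n' ltnS.
  apply: leq_trans (leq_addl _ _); rewrite leq_mul2l leq_exp2l // (ltnW iL) orbT.
  by [].
rewrite dT_ebas /D (vQ j).2 /new; have [j2 j3] := logn23 n i.
by rewrite -/j in j2 j3; case: (j) j0 j2 j3 => // l _ -> ->; rewrite ti.
Qed.

End Stages.

(** * Invariance of compactness under quasi-isomorphism *)

Section Augmentation.
Variables (B : dga) (k : gring) (eps : dga_hom B (dga_of_gring k)) (T : semifree B).
Hypotheses (g0 : sfg T 0%N = 0) (eb : forall j, eps (coef (sfb T j) 0) = 0).

Definition sf_aug : dgmod_hom (sfmod T) (dgmod_of_hom eps).
Proof.
apply: (@build_dgmod_hom B (sfmod T) (dgmod_of_hom eps) (fun x => eps (coef x 0))).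
- by move=> x y; rewrite coefD rmorphD.
- by move=> a x; rewrite coefZ rmorphM.
- by move=> n x /fs_homogP/(_ 0%N); rewrite g0 subr0; apply: gring_fun_homog.
- by move=> x; apply: eps_dT.
Defined.

Lemma sf_augE x : sf_aug x = eps (coef x 0). Proof. by []. Qed.

Definition surj_homology : Prop := forall y, exists2 x, dgad B x = 0 & eps x = y.

Lemma sf_aug_qis : surj_homology -> sfb T 0%N = 0 ->
  (forall n, exists n', forall x, rcycle eps (sfb T) n x ->
     exists2 y, below n' y & dT (sfb T) y = x) -> dgmod_quasi_iso sf_aug.
Proof.
move=> se b0 kill; split=> [x dx [y ex]|y _].
  have [n nx] := below_ex x; have [n' kn] := kill n.
  by have [|z _ <-] := kn x; [split|exists z].
have [x dx <-] := se y; exists (x *: ebas B 0); split.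
  by rewrite sfdE dTZ dx scale0r add0r dT_ebas b0 scaler0.
by exists 0; rewrite sf_augE coefZ coef_ebas eqxx mulr1 diff0 addr0.
Qed.

End Augmentation.

Section Invariance.
Variables (k : gring) (X Y : aug_dga k) (f : dga_hom (aug_alg X) (aug_alg Y)).
Hypotheses (fq : dga_quasi_iso f) (fe : forall x, aug_map Y (f x) = aug_map X x).

Lemma surj_homology_push : surj_homology (aug_map X) -> surj_homology (aug_map Y).
Proof.
move=> sX y; have [x dx <-] := sX y; exists (f x); last exact: fe.
by rewrite -dga_fun_d dx rmorph0.
Qed.

Lemma surj_homology_pull : surj_homology (aug_map Y) -> surj_homology (aug_map X).
Proof.
move=> sY y; have [x dx <-] := sY y; have [_ fsur] := fq.
have [x' [dx' [z ->]]] := fsur x dx.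
by exists x' => //; rewrite rmorphD eps_d addr0 fe.
Qed.

Lemma compact_push : noetherian_homology (aug_alg X) -> surj_homology (aug_map X) ->
  (homotopically_regular (aug_map X) <-> homotopically_regular (aug_map Y)).
Proof.
move=> nX sX; have [T [w [[g0 b0] _ eb kill _]]] := sf_resolution_ex (aug_map X) nX.
have qX := sf_aug_qis g0 eb sX b0 kill.
have eb' j : aug_map Y (coef (sfb (sfpush f T) j) 0) = 0 by rewrite /= coef_push fe eb.
pose qY := sf_aug (T := sfpush f T) g0 eb'.
have [_ psur] := push_qis T fq; have [qinj qsur] := qX.
have qYE x : qY (push f x) = sf_aug g0 eb x by rewrite !sf_augE coef_push fe.
have qYq : dgmod_quasi_iso qY.
  split=> [x dx [y qx]|y dy].
    have [x' [dx' [z xE]]] := psur x dx; rewrite {}xE in qx *.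
    have [|y' ->] := qinj x' dx'.
      exists 0; rewrite -qYE.
      have : qY (push f x' + dgmd _ z) = 0 by rewrite qx.
      by rewrite ghD dgmod_fun_d addr0.
    exists (push f y' + z); rewrite diffD; congr (_ + _).
    exact: push_dT.
  have [x [dx [z ->]]] := qsur y dy; exists (push f x); split.
    by rewrite sfdE -(push_dT f (sfb T)) -sfdE dx push0.
  by exists z; rewrite qYE.
split=> [/(compact_bounded qX)|/(compact_bounded qYq)].
  by move=> /(push_bounded f)/(bounded_compact qYq).
by move=> /(bounded_push fq)/(bounded_compact qX).
Qed.

End Invariance.

Lemma zigzag_compact (k : gring) (X Y : aug_dga k) :
  clos_refl_sym_trans (aug_dga k) (@aug_quasi_iso k) X Y ->
  let good Z := noetherian_homology (aug_alg Z) /\ surj_homology (aug_map Z) in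
  (good X <-> good Y) /\
  (good X -> (homotopically_regular (aug_map X) <-> homotopically_regular (aug_map Y))).
Proof.
move=> XY good.
have : (good X <-> good Y) /\
  (good X -> (homotopically_regular (aug_map X) <-> homotopically_regular (aug_map Y))).
  elim: XY => {X Y} [X Y [f [fq fe]]|X|X Y _ [gXY cXY]|X Y Z _ [gXY cXY] _ [gYZ cYZ]].
  - split; last by move=> [nX sX]; apply: (compact_push fq fe).
    split=> -[n s]; split.
    + exact: noetherian_push fq n.
    + exact: surj_homology_push fe s.
    + exact: noetherian_pull fq n.
    + exact: surj_homology_pull fq fe s.
  - by split.
  - by split=> [|gY]; [split=> /gXY|apply: iff_sym; apply/cXY/gXY].
  - split; first exact: iff_trans gXY gYZ.
    by move=> gX; apply: iff_trans (cXY gX) (cYZ _); apply/gXY.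
by [].
Qed.

(** * Graded modules *)

Section TwistedSign.
Variable R : gring.

Definition tsgn (n : int) (a : R) : R := iter `|n|%N (@sgn R) a.

Lemma tsgnK n : involutive (tsgn n).
Proof.
move=> a; rewrite /tsgn -iterD; elim: `|n|%N => //= m IH.
by rewrite addnS /= IH sgnK.
Qed.

Lemma tsgnM n a b : tsgn n (a * b) = tsgn n a * tsgn n b.
Proof. by rewrite /tsgn; elim: `|n|%N => //= m ->; rewrite sgnM. Qed.

Lemma tsgnD n a b : tsgn n (a + b) = tsgn n a + tsgn n b.
Proof. by rewrite /tsgn; elim: `|n|%N => //= m ->; rewrite sgnD. Qed.

Lemma tsgn1 n : tsgn n 1 = 1.
Proof. by rewrite /tsgn; elim: `|n|%N => //= m ->; rewrite sgn1. Qed.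

Lemma tsgn_homog n m a : homog (grg R) m a -> homog (grg R) m (tsgn n a).
Proof. by move=> ha; rewrite /tsgn; elim: `|n|%N => //= l; apply: homog_sgn. Qed.

Lemma tsgnN n a : tsgn (- n) a = tsgn n a.
Proof. by rewrite /tsgn abszN. Qed.

Lemma tsgnS (n : nat) a : tsgn n.+1 a = tsgn n (sgn a).
Proof. by rewrite /tsgn /= -iterSr. Qed.

Lemma sgn_tsgnS (n : nat) a : sgn (tsgn n.+1 a) = tsgn n a.
Proof. by rewrite /tsgn /= sgnK. Qed.

End TwistedSign.

Definition shift_carrier (R : gring) (n : int) (M : gmod R) : Type := M.

Section Shift.
Variables (R : gring) (n : int) (M : gmod R).
Notation S := (shift_carrier n M).

HB.instance Definition _ := GRing.Zmodule.on S.

Definition shift_scale (a : R) (x : S) : S := tsgn n a *: (x : M).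

Lemma shift_scaleA a b x : shift_scale a (shift_scale b x) = shift_scale (a * b) x.
Proof. by rewrite /shift_scale tsgnM scalerA. Qed.
Lemma shift_scale1 : left_id 1 shift_scale.
Proof. by move=> x; rewrite /shift_scale tsgn1 scale1r. Qed.
Lemma shift_scaleDr : right_distributive shift_scale +%R.
Proof. by move=> a x y; apply: scalerDr. Qed.
Lemma shift_scaleDl x : {morph shift_scale^~ x : a b / a + b}.
Proof. by move=> a b; rewrite /shift_scale tsgnD scalerDl. Qed.

HB.instance Definition _ := GRing.Zmodule_isLmodule.Build R S
  shift_scaleA shift_scale1 shift_scaleDr shift_scaleDl.

Definition shift_gpr (m : int) (x : S) : S := gmg M (m - n) x.

Lemma shift_gprB m x y : shift_gpr m (x - y) = shift_gpr m x - shift_gpr m y.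
Proof. exact: gprB. Qed.

Lemma shift_gpr_pr m l x :
  shift_gpr m (shift_gpr l x) = if m == l then shift_gpr l x else 0.
Proof. by rewrite /shift_gpr gpr_pr (inj_eq (addIr _)). Qed.

Lemma shift_gpr_fin x : exists2 s : seq int, uniq s & x = \sum_(m <- s) shift_gpr m x.
Proof.
have [s us xE] := gpr_fin (gmg M) x; exists [seq m + n | m <- s].
  by rewrite map_inj_uniq //; apply: addIr.
by rewrite big_map {1}xE; apply: eq_bigr => m _; rewrite /shift_gpr addrK.
Qed.

Definition shift_grading : grading S := Grading shift_gprB shift_gpr_pr shift_gpr_fin.

Lemma shift_homogZ m l (a : R) (x : S) : homog (grg R) m a ->
  homog shift_grading l x -> homog shift_grading (m + l) (a *: x).
Proof.
move=> ha hx; rewrite /homog /= /shift_gpr -addrA.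
by apply: (@homogZ R M) hx; apply: tsgn_homog.
Qed.

(* The suspension M[n], on which a acts as (-1)^(n|a|) a. *)
Definition gshift : gmod R := GMod shift_homogZ.

Lemma shift_scaleE (a : R) (x : gshift) : a *: x = tsgn n a *: (x : M).
Proof. by []. Qed.

End Shift.

Record gsub (R : gring) (M : gmod R) := GSub {
  gsub_set :> M -> Prop;
  gsub_0 : gsub_set 0;
  gsub_D : forall x y, gsub_set x -> gsub_set y -> gsub_set (x + y);
  gsub_Z : forall (a : R) x, gsub_set x -> gsub_set (a *: x);
  gsub_G : forall n x, gsub_set x -> gsub_set (gmg M n x) }.

Section Submodule.
Variables (R : gring) (M : gmod R) (S : gsub M).

Definition gsub_pred : {pred M} := fun x => `[< S x >].

Lemma gsub_closed : submod_closed gsub_pred.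
Proof.
split=> [|a x y /asboolP Sx /asboolP Sy]; apply/asboolP; first exact: gsub_0.
by apply: gsub_D => //; apply: gsub_Z.
Qed.
HB.instance Definition _ := GRing.isSubmodClosed.Build R M gsub_pred gsub_closed.

Definition gsub_carrier := {x : M | x \in gsub_pred}.
HB.instance Definition _ := SubType.on gsub_carrier.
HB.instance Definition _ := Choice.on gsub_carrier.
HB.instance Definition _ := [SubChoice_isSubLmodule of gsub_carrier by <:].

Lemma gsub_valP (x : gsub_carrier) : S (\val x).
Proof. exact/asboolP/(valP x). Qed.

Definition gsub_mk x (Sx : S x) : gsub_carrier :=
  exist (fun x => x \in gsub_pred) x (asboolT Sx).

Definition gsub_gpr n (x : gsub_carrier) : gsub_carrier :=
  gsub_mk (gsub_G n (gsub_valP x)).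

Lemma gsub_gprB n x y : gsub_gpr n (x - y) = gsub_gpr n x - gsub_gpr n y.
Proof. by apply: val_inj; rewrite raddfB /= -gprB. Qed.

Lemma gsub_gpr_pr m n x : gsub_gpr m (gsub_gpr n x) = if m == n then gsub_gpr n x else 0.
Proof. by apply: val_inj; rewrite /= gpr_pr; case: (m == n). Qed.

Lemma gsub_gpr_fin x : exists2 s : seq int, uniq s & x = \sum_(n <- s) gsub_gpr n x.
Proof.
have [s us xE] := gpr_fin (gmg M) (\val x); exists s => //.
by apply: val_inj; rewrite raddf_sum.
Qed.

Definition gsub_grading : grading gsub_carrier :=
  Grading gsub_gprB gsub_gpr_pr gsub_gpr_fin.

Lemma gsub_homogP n (x : gsub_carrier) :
  homog gsub_grading n x <-> homog (gmg M) n (\val x).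
Proof.
split=> [hx|hx]; last exact: val_inj.
by rewrite /homog -[in RHS]hx.
Qed.

Lemma gsub_homogZ m n (a : R) (x : gsub_carrier) : homog (grg R) m a ->
  homog gsub_grading n x -> homog gsub_grading (m + n) (a *: x).
Proof. by move=> ha /gsub_homogP hx; apply/gsub_homogP; apply: homogZ. Qed.

Definition gsubmod : gmod R := GMod gsub_homogZ.

Definition gincl : gmod_hom gsubmod M :=
  @build_gmod_hom R gsubmod M (fun x => \val (x : gsub_carrier))
    (fun _ _ => erefl) (fun _ _ => erefl) (fun n x => (gsub_homogP n x).1).

Lemma gincl_inj (x y : gsubmod) : gincl x = gincl y -> x = y.
Proof. exact: val_inj. Qed.

Lemma ginclP (x : gsubmod) : S (gincl x).
Proof. exact: gsub_valP. Qed.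

Section Corestriction.
Variables (N : gmod R) (f : gmod_hom N M).
Hypothesis fS : forall x, S (f x).

Lemma gcorestrD (x y : N) : (gsub_mk (fS (x + y)) : gsubmod) = gsub_mk (fS x) + gsub_mk (fS y).
Proof. by apply: gincl_inj; apply: ghD. Qed.

Lemma gcorestrZ (a : R) (x : N) : (gsub_mk (fS (a *: x)) : gsubmod) = a *: gsub_mk (fS x).
Proof. by apply: gincl_inj; apply: ghZ. Qed.

Lemma gcorestrG n (x : N) : homog (gmg N) n x -> homog (gmg gsubmod) n (gsub_mk (fS x)).
Proof. by move=> hx; apply/gsub_homogP; apply: gmod_hom_homog. Qed.

Definition gcorestr : gmod_hom N gsubmod :=
  @build_gmod_hom R N gsubmod (fun x => gsub_mk (fS x)) gcorestrD gcorestrZ gcorestrG.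

Lemma gcorestrE x : gincl (gcorestr x) = f x.
Proof. by []. Qed.

End Corestriction.

End Submodule.

Definition gmod_comp (R : gring) (M N P : gmod R) (f : gmod_hom N P) (h : gmod_hom M N) :
  gmod_hom M P.
Proof.
apply: (@build_gmod_hom R M P (f \o h)) => /=.
- by move=> x y; rewrite !ghD.
- by move=> a x; rewrite !ghZ.
- by move=> n x hx; do 2!apply: gmod_hom_homog.
Defined.

Lemma retract_projective (R : gring) (F P : gmod R) (r : gmod_hom F P) (i : gmod_hom P F) :
  (forall x, r (i x) = x) -> gprojective F -> gprojective P.
Proof.
move=> ri pF M N p f ps; have [l lE] := pF M N p (gmod_comp f r) ps.
by exists (gmod_comp l i) => x; rewrite lE /= ri.
Qed.

Lemma free_projective (B : dga) (g : nat -> int) (n : int) :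
  gprojective (gshift n (fsgmod B g)).
Proof.
move=> M N p f ps.
have m_ex j : exists m, homog (gmg M) (g j + n) m /\ p m = f (ebas B j).
  have [m pm] := ps (f (ebas B j)); exists (gmg M (g j + n) m); split.
    exact: homog_gpr.
  rewrite gmod_fun_pr pm; apply: gmod_hom_homog; rewrite /homog /= /shift_gpr addrK.
  exact: ebas_homog.
pose m j := sval (cid (m_ex j)).
have mP j : homog (gmg M) (g j + n) (m j) /\ p (m j) = f (ebas B j).
  exact: (svalP (cid (m_ex j))).
pose tv : fsmod B -> fsmod B := iter `|n|%N (@vsgn B).
have tv0 : tv 0 = 0 by rewrite /tv; elim: `|n|%N => //= l ->; rewrite vsgn0.
have tvD x y : tv (x + y) = tv x + tv y.
  by rewrite /tv; elim: `|n|%N => //= l ->; rewrite vsgnD.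
have tvZ (a : B) x : tv (a *: x) = tsgn n a *: tv x.
  by rewrite /tv /tsgn; elim: `|n|%N => //= l ->; rewrite vsgnZ.
have tve j : tv (ebas B j) = ebas B j.
  by rewrite /tv; elim: `|n|%N => //= l ->; rewrite vsgn_ebas.
have tvG r x : homog (fsgrading B g) r x -> homog (fsgrading B g) r (tv x).
  by move=> hx; rewrite /tv; elim: `|n|%N => //= l; apply: vsgn_homog.
have lD (x y : gshift n (fsgmod B g)) : lin m (tv (x + y)) = lin m (tv x) + lin m (tv y).
  by rewrite tvD linD.
have lZ (a : B) (x : gshift n (fsgmod B g)) : lin m (tv (a *: x)) = a *: lin m (tv x).
  by rewrite shift_scaleE tvZ linZ tsgnK.
have lG r (x : gshift n (fsgmod B g)) :
    homog (gmg (gshift n (fsgmod B g))) r x -> homog (gmg M) r (lin m (tv x)).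
  rewrite {1}/homog /= /shift_gpr => /tvG hx; have [K xK] := below_ex (tv x).
  rewrite -(subrK n r); apply: (lin_homog (g := g) _ xK hx) => j _.
  by case: (mP j).
exists (@build_gmod_hom B (gshift n (fsgmod B g)) M _ lD lZ lG).
move=> x /=; elim/fs_ind: x => [|x y hx hy|a j].
- by rewrite tv0 lin0 !gh0.
- by rewrite tvD linD ghD hx hy; apply/esym/(ghD f).
rewrite tvZ tve linZ lin_ebas ghZ (mP j).2 -(ghZ f); congr (f _).
by rewrite shift_scaleE tsgnK.
Qed.

(** * Projective dimension over a graded ring *)

Section BoundedProjdim.
Variables (R k : gring) (pi : gring_hom R k).
Let B := dga_of_gring R.
Let eps : dga_hom B (dga_of_gring k) := dga_hom_of_gring pi.
Notation V := (fsmod B).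
Variables (T : semifree B) (w : nat -> nat).
Hypotheses (g0 : sfg T 0%N = 0) (b0 : sfb T 0%N = 0) (w0 : w 0%N = 0%N).
Hypothesis eb : forall j, eps (coef (sfb T j) 0) = 0.
Hypothesis kill : forall n, exists n', forall x, rcycle eps (sfb T) n x ->
  exists2 y, below n' y & dT (sfb T) y = x.
Hypothesis wb : weighted (sfb T) w.
Hypothesis pi_surj : forall y, exists x, pi x = y.
Notation d := (dT (sfb T)).
Notation g := (sfg T).

Let d0 (x : B) : dgad B x = 0. Proof. by []. Qed.

Lemma dT_sgn (a : B) x : d (a *: x) = sgn a *: d x.
Proof. by rewrite dTZ d0 scale0r add0r. Qed.

Lemma sf_exact x : d x = 0 -> eps (coef x 0) = 0 -> exists y, d y = x.
Proof.
move=> dx ex; have [n nx] := below_ex x; have [n' kn] := kill n.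
by have [|y _ <-] := kn x; [split|exists y].
Qed.

Section Linear.
Variables (n m : int) (F : V -> V).
Hypotheses (FD : forall x y, F (x + y) = F x + F y).
Hypotheses (FZ : forall (a : B) x, F (tsgn n a *: x) = tsgn m a *: F x).
Hypotheses (FG : forall r x, homog (fsgrading B g) (r - n) x ->
  homog (fsgrading B g) (r - m) (F x)).

Definition shift_hom : gmod_hom (gshift n (fsgmod B g)) (gshift m (fsgmod B g)) :=
  @build_gmod_hom R (gshift n (fsgmod B g)) (gshift m (fsgmod B g)) F FD FZ FG.

End Linear.

Definition layer (n : nat) : gmod R := gshift (- n%:Z) (fsgmod B g).

Lemma layer_dZ (n : nat) (a : B) x :
  d (tsgn (- n.+1%:Z) a *: x) = tsgn (- n%:Z) a *: d x.
Proof. by rewrite dT_sgn !tsgnN sgn_tsgnS. Qed.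

Lemma layer_dG (n : nat) r x : homog (fsgrading B g) (r - - n.+1%:Z) x ->
  homog (fsgrading B g) (r - - n%:Z) (d x).
Proof.
move=> /(sf_dhomog (T := T)); rewrite (_ : r - - n%:Z = r - - n.+1%:Z - 1) //.
by rewrite !opprK -addn1 PoszD addrA addrK.
Qed.

Definition layer_d (n : nat) : gmod_hom (layer n.+1) (layer n) :=
  shift_hom (dTD (sfb T)) (layer_dZ n) (@layer_dG n).

Lemma layer_augZ (a : B) (x : layer 0) : eps (coef (a *: x) 0) =
  (a *: (eps (coef x 0) : gmod_of_hom pi)).
Proof. by rewrite shift_scaleE coefZ; apply: rmorphM. Qed.

Lemma layer_augG r (x : layer 0) : homog (gmg (layer 0)) r x ->
  homog (gmg (gmod_of_hom pi)) r (eps (coef x 0)).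
Proof.
rewrite {1}/homog /= /shift_gpr oppr0 subr0 => /fs_homogP/(_ 0%N).
by rewrite g0 subr0; apply: (gring_fun_homog pi).
Qed.

Definition layer_aug : gmod_hom (layer 0) (gmod_of_hom pi) :=
  @build_gmod_hom R (layer 0) (gmod_of_hom pi) (fun x => eps (coef x 0))
    (fun x y => rmorphD pi (coef x 0) (coef y 0)) layer_augZ layer_augG.

Section FiniteLength.
Variables (h : V -> V) (N : nat).
Hypotheses (hD : forall x y, h (x + y) = h x + h y).
Hypotheses (hZ : forall (a : B) x, h (a *: x) = sgn a *: h x).
Hypothesis hG : forall n x, homog (fsgrading B g) n x -> homog (fsgrading B g) (n + 1) (h x).
Hypothesis hN : forall z, wt w N.+1 (z - d (h z) - h (d z)) = 0.

Let h0 : h 0 = 0.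
Proof. by rewrite -[X in h X](scale0r (0 : V)) hZ sgn0 scale0r. Qed.

(* The n-th term of the finite resolution is the image of this idempotent:   *)
(* the whole layer for n <= N, and for n = N+1 a summand that d maps         *)
(* isomorphically onto the cycles of the layer N.                            *)
Definition rho (n : nat) (x : V) : V :=
  if (n <= N)%N then wt w n x
  else if n == N.+1 then wt w n (h (d (wt w n x))) else 0.

Lemma rhoD n x y : rho n (x + y) = rho n x + rho n y.
Proof.
rewrite /rho; case: ifP => _; first exact: wtD.
by case: ifP => _; rewrite ?addr0 // !wtD dTD hD wtD.
Qed.

Lemma rhoZ n (a : B) x : rho n (a *: x) = a *: rho n x.
Proof.
rewrite /rho; case: ifP => _; first exact: wtZ.
by case: ifP => _; rewrite ?scaler0 // !wtZ dT_sgn hZ sgnK wtZ.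
Qed.

Lemma rho0 n : rho n 0 = 0.
Proof. by rewrite -[X in rho n X](scale0r (0 : V)) rhoZ scale0r. Qed.

Lemma rhoG n r x : homog (fsgrading B g) r x -> homog (fsgrading B g) r (rho n x).
Proof.
move=> hx; rewrite /rho; case: ifP => _; first exact: wt_homog.
case: ifP => _; last exact: homog0.
apply: wt_homog; rewrite -(subrK 1 r); apply/hG/(sf_dhomog (T := T)).
exact: wt_homog.
Qed.

Lemma wtK n (x : V) : wt w n (wt w n x) = wt w n x.
Proof. exact/pure_wt/wt_pure. Qed.

Lemma d_top (x : V) : d (wt w N.+1 (h (d (wt w N.+1 x)))) = d (wt w N.+1 x).
Proof.
move: (wt w N.+1 x) (wtK N.+1 x) => z zE.
have := hN z; rewrite !wtB zE -(dT_wt d0 _ _ wb) => /eqP; rewrite subr_eq0 => /eqP <-.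
by rewrite dTB sf_dK subr0.
Qed.

Lemma rhoK n x : rho n (rho n x) = rho n x.
Proof.
rewrite /rho; case: (n <= N)%N; first exact: wtK.
by case: (n =P N.+1) => [->|//]; rewrite wtK d_top.
Qed.

Lemma rho_wt n x : rho n x = x -> wt w n x = x.
Proof.
rewrite /rho; case: ifP => // _; case: eqP => _ xE; first by rewrite -xE wtK.
by rewrite -xE wt0.
Qed.

Lemma rho_d n x : rho n.+1 x = x -> rho n (d x) = d x.
Proof.
move=> xE; have xw := rho_wt xE; move: xE; rewrite /rho; case: ltnP => nN.
  by rewrite (ltnW nN) -(dT_wt d0 _ _ wb) xw.
case: eqP => [[nE] _|_ <-]; first by rewrite nE leqnn -(dT_wt d0 _ _ wb) -nE xw.
by rewrite dT0; apply: (rho0 n).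
Qed.

Lemma rho_exact n x : rho n x = x -> d x = 0 -> eps (coef x 0) = 0 ->
  exists2 y, rho n.+1 y = y & d y = x.
Proof.
move=> xE dx ex; have xw := rho_wt xE; have [y yE] := sf_exact dx ex.
exists (rho n.+1 y); first exact: rhoK.
have wy : d (wt w n.+1 y) = x by rewrite (dT_wt d0 _ _ wb) yE.
rewrite {1}/rho; case: ltnP => [//|Nn].
case: eqP => [[nN]|/eqP nN]; first by rewrite nN d_top -nN.
rewrite dT0 -xE /rho leqNgt; move: nN; rewrite eqSS => nN.
rewrite ltn_neqAle eq_sym nN Nn /=; case: eqP => // nN1.
by rewrite xw dx h0 wt0.
Qed.

Lemma rho_fixG n m x : rho n x = x -> rho n (gr g m x) = gr g m x.
Proof.
move=> xE; rewrite -{2}xE.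
have /= := build_gpr (M := fsgmod B g) (N := fsgmod B g) (rhoD n) (rhoZ n) (@rhoG n).
exact.
Qed.

Definition rho_sub n : gsub (layer n).
Proof.
exists (fun x : V => rho n x = x).
- exact: rho0.
- by move=> x y xE yE; rewrite rhoD xE yE.
- by move=> a x xE; rewrite shift_scaleE rhoZ xE.
- by move=> m x; apply: rho_fixG.
Defined.

Definition rho_hom n : gmod_hom (layer n) (layer n) :=
  shift_hom (rhoD n) (fun a => @rhoZ n (tsgn (- n%:Z) a)) (fun r x => @rhoG n (r - - n%:Z) x).

Lemma bounded_projdim : finite_projdim (gmod_of_hom pi).
Proof.
pose P n := gsubmod (rho_sub n).
have Pd n (x : P n.+1) : rho_sub n (gmod_comp (layer_d n) (gincl (rho_sub n.+1)) x).
  exact: rho_d (ginclP x).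
exists P, (fun n => gcorestr (Pd n)), (gmod_comp layer_aug (gincl (rho_sub 0))), N.+1.
have dE n (x : P n.+1) : gincl _ (gcorestr (Pd n) x) = d (gincl _ x) :> V by [].
have eE (x : P 0%N) : gmod_comp layer_aug (gincl (rho_sub 0)) x = pi (coef (gincl _ x : V) 0).
  by [].
split.
- move=> n; pose r := gcorestr (S := rho_sub n) (f := rho_hom n) (@rhoK n).
  apply: (@retract_projective R (layer n) (P n) r (gincl _)); last exact: (@free_projective B g (- n%:Z)).
  by move=> x; apply: gincl_inj; rewrite gcorestrE; apply: (ginclP x).
- move=> y; have [a <-] := pi_surj y.
  have aE : rho_sub 0 (a *: ebas B 0 : V).
    by rewrite /= /rho leq0n wtZ wt_ebas w0 eqxx.
  by exists (gsub_mk aE); rewrite eE /= coefZ coef_ebas eqxx mulr1.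
- move=> x; rewrite eE; split=> [ex|[y ->]]; last by rewrite dE; apply: (eps_dT (eps := eps)).
  have [|y yE dy] := rho_exact (ginclP x) _ ex.
    have := rho_wt (ginclP x) => <-; exact: (dT_wt0 d0).
  by exists (gsub_mk (S := rho_sub 1) yE); apply: gincl_inj; rewrite dE.
- move=> n x; split=> [dx|[y ->]]; last first.
    by apply: gincl_inj; rewrite !dE; apply: sf_dK.
  have {}dx : d (gincl _ x) = 0 by rewrite -dE dx.
  have xw := rho_wt (ginclP x).
  have [|y yE dy] := rho_exact (ginclP x) dx.
    by rewrite -xw coef_wt w0 /= rmorph0.
  by exists (gsub_mk (S := rho_sub n.+2) yE); apply: gincl_inj; rewrite dE.
- move=> n x Nn; apply: gincl_inj; rewrite gh0 -[LHS](ginclP x) /= /rho.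
  by rewrite leqNgt (ltnW Nn) /= gtn_eqF.
Qed.

End FiniteLength.

Lemma sf_bounded_projdim : sf_bounded T -> finite_projdim (gmod_of_hom pi).
Proof.
move=> /bounded_retract[n [r [[h [hB hG hZ hE]] rn]]].
pose N := \max_(i < n) w i.
apply: (@bounded_projdim h N) => //.
- exact: subr_morphD hB.
- exact: homotopy_sgn hB hZ.
move=> z; rewrite -addrA -opprD (_ : d (h z) + h (d z) = z - r z); last exact/esym/(hE z).
rewrite subKr; apply: coef_ext => i.
rewrite coef_wt; case: eqP => // wi; have [ni|lin] := leqP n i; first exact: rn.
have := leq_bigmax (F := fun i : 'I_n => w i) (Ordinal lin).
by rewrite /= wi ltnn.
Qed.

End BoundedProjdim.

Lemma dep_seq_choice (A : nat -> Type) (G : forall i, A i -> Prop)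
    (Q : forall i, A i -> A i.+1 -> Prop) :
  (exists a, G 0%N a) -> (forall i a, G i a -> exists a', G i.+1 a' /\ Q i a a') ->
  exists s : forall i, A i, forall i, G i (s i) /\ Q i (s i) (s i.+1).
Proof.
move=> /cid[a0 Ga0] step.
pose st := fix st i : {a : A i | G i a} := match i with
  | 0 => exist _ a0 Ga0
  | j.+1 => let a := st j in let e := cid (step j (sval a) (svalP a)) in
            exist _ (sval e) (svalP e).1
  end.
exists (fun i => sval (st i)) => i; split; first exact: svalP.
exact: (svalP (cid (step i (sval (st i)) (svalP (st i))))).2.
Qed.

Section ZeroDifferentialModule.
Variables (R : gring) (M : gmod R).
Let B := dga_of_gring R.

Lemma zero_mod_leibniz n (a : B) (x : M) : homog (grg B) n a ->
  zero_diff (gmg M) (a *: x) = dgad B a *: x + ksign B n *: (a *: zero_diff (gmg M) x).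
Proof. by move=> _ /=; rewrite !scaler0 scale0r addr0. Qed.

Definition zero_dgmod : dgmod B := @DGMod B M (zero_diff (gmg M)) zero_mod_leibniz.

End ZeroDifferentialModule.

Section Total.
Variables (R : gring) (P : nat -> gmod R) (d : forall n, gmod_hom (P n.+1) (P n)).
Variable N : nat.
Hypothesis dd : forall n x, d n (d n.+1 x) = 0.
Hypothesis PN : forall n (x : P n), (N < n)%N -> x = 0.
Let B := dga_of_gring R.
Let M (n : nat) : dgmod B := zero_dgmod (gshift n%:Z (P n)).

Definition tot_gmod : gmod B := dgmod_mod (dsum M).

Definition tot_coef (x : tot_gmod) (n : nat) : P n := dval (x : dsum_carrier M) n.

Lemma tot_fin (f : forall n, P n) : (f : dprod M) \in @finsupp_pred B nat M.
Proof.
apply/asboolP; exists (iota 0 N.+1) => n; rewrite mem_iota /= add0n -leqNgt.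
exact: PN.
Qed.

Definition tot_mk (f : forall n, P n) : tot_gmod :=
  exist (fun y : dprod M => y \in @finsupp_pred B nat M) f (tot_fin f).

Lemma tot_coef_mk f n : tot_coef (tot_mk f) n = f n. Proof. by []. Qed.

Lemma tot_ext x y : (forall n, tot_coef x n = tot_coef y n) -> x = y.
Proof. by move=> xy; apply: (@dsum_ext B nat M) => n; apply: xy. Qed.

Lemma tot_coefZ (a : B) x n : tot_coef (a *: x) n = tsgn n%:Z a *: tot_coef x n.
Proof. by []. Qed.

Lemma tot_homogP r x :
  homog (gmg tot_gmod) r x <-> forall n, homog (gmg (P n)) (r - n%:Z) (tot_coef x n).
Proof. exact: (dsum_homogP (M := M)). Qed.

Definition tot_d (x : tot_gmod) : tot_gmod := tot_mk (fun n => d n (tot_coef x n.+1)).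

Lemma tot_dB x y : tot_d (x - y) = tot_d x - tot_d y.
Proof. by apply: tot_ext => n; apply: (ghB (d n)). Qed.

Lemma tot_dK x : tot_d (tot_d x) = 0.
Proof. by apply: tot_ext => n; apply: dd. Qed.

Lemma tot_d_homog r x : homog (gmg tot_gmod) r x -> homog (gmg tot_gmod) (r - 1) (tot_d x).
Proof.
move=> /tot_homogP hx; apply/tot_homogP => n; rewrite tot_coef_mk.
apply: gmod_hom_homog; rewrite (_ : r - 1 - n%:Z = r - n.+1%:Z) //.
by lia.
Qed.

Definition tot_diff : differential (gmg tot_gmod) := Differential tot_dB tot_dK tot_d_homog.

Lemma tot_leibniz n (a : B) (x : tot_gmod) : homog (grg B) n a ->
  tot_diff (a *: x) = dgad B a *: x + ksign B n *: (a *: tot_diff x).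
Proof.
move=> ha; rewrite scale0r add0r scalerA -(sgn_homog ha); apply: tot_ext => i.
by rewrite tot_coefZ /= !tot_coef_mk tot_coefZ ghZ tsgnS.
Qed.

Definition tot : dgmod B := @DGMod B tot_gmod tot_diff tot_leibniz.

End Total.

Section ProjdimBounded.
Variables (R k : gring) (pi : gring_hom R k).
Let B := dga_of_gring R.
Let eps : dga_hom B (dga_of_gring k) := dga_hom_of_gring pi.
Notation V := (fsmod B).
Variable T : semifree B.
Hypotheses (g0 : sfg T 0%N = 0) (b0 : sfb T 0%N = 0).
Hypothesis eb : forall j, eps (coef (sfb T j) 0) = 0.
Hypothesis kill : forall n, exists n', forall x, rcycle eps (sfb T) n x ->
  exists2 y, below n' y & dT (sfb T) y = x.
Hypothesis pi_surj : forall y, exists x, pi x = y.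
Notation d := (dT (sfb T)).
Notation g := (sfg T).

Variables (P : nat -> gmod R) (dP : forall n, gmod_hom (P n.+1) (P n)).
Variables (eP : gmod_hom (P 0%N) (gmod_of_hom pi)) (N : nat).
Hypothesis P_proj : forall n, gprojective (P n).
Hypothesis eP_surj : forall y, exists x, eP x = y.
Hypothesis exact0 : forall x, eP x = 0 <-> exists y, x = dP 0%N y.
Hypothesis exactS : forall n (x : P n.+1), dP n x = 0 <-> exists y, x = dP n.+1 y.
Hypothesis P_fin : forall n (x : P n), (N < n)%N -> x = 0.

Let L n := layer T n.

Let dZ (a : B) x : d (a *: x) = sgn a *: d x.
Proof. by rewrite dTZ scale0r add0r. Qed.

Let d_below1 x : below 1 x -> d x = 0.
Proof.
move=> x1; rewrite (fs_sum x1) big_ord_recl big_ord0 addr0 dZ dT_ebas b0.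
by rewrite scaler0.
Qed.

Definition below_sub (l n : nat) : gsub (L l).
Proof.
exists (fun x : V => below n x).
- exact: below_0.
- by move=> x y; apply: belowD.
- by move=> a x; apply: belowZ.
- by move=> m x; apply: gr_below.
Defined.

Let ecoefZ (a : B) (x : V) : eps (coef x 0) = 0 -> eps (coef (a *: x) 0) = 0.
Proof. by move=> ex; rewrite coefZ rmorphM ex mulr0. Qed.

Let ecoefG m (x : V) : eps (coef x 0) = 0 -> eps (coef (gr g m x) 0) = 0.
Proof. by move=> ex; rewrite coef_gr gring_fun_pr ex gpr0. Qed.

Lemma rcycleD n x y : rcycle eps (sfb T) n x -> rcycle eps (sfb T) n y ->
  rcycle eps (sfb T) n (x + y).
Proof.
move=> [nx dx ex] [ny dy ey]; split; first exact: belowD.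
  by rewrite dTD dx dy addr0.
by rewrite coefD rmorphD ex ey addr0.
Qed.

Lemma rcycleZ n (a : B) x : rcycle eps (sfb T) n x -> rcycle eps (sfb T) n (a *: x).
Proof.
by move=> [nx dx ex]; split; [apply: belowZ|rewrite dZ dx scaler0|apply: ecoefZ].
Qed.

Lemma rcycleG n m x : rcycle eps (sfb T) n x -> rcycle eps (sfb T) n (gr g m x).
Proof.
by move=> [nx dx ex]; split; [apply: gr_below|rewrite sf_dgr dx gr0|apply: ecoefG].
Qed.

Lemma rcycle0 n : rcycle eps (sfb T) n 0.
Proof. by split; [exact: below_0|exact: dT0|exact: rmorph0]. Qed.

Definition rcycle_sub (l n : nat) : gsub (L l).
Proof.
exists (fun x : V => rcycle eps (sfb T) n x); first exact: rcycle0.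
- by move=> x y; apply: rcycleD.
- by move=> a x; apply: rcycleZ.
- by move=> m x; apply: rcycleG.
Defined.

Definition rbound_sub (l n n' : nat) : gsub (L l).
Proof.
exists (fun x : V => [/\ below n' x, rcycle eps (sfb T) n (d x) & eps (coef x 0) = 0]).
- by split; rewrite ?dT0; [exact: below_0|exact: rcycle0|exact: rmorph0].
- move=> x y [nx rx ex] [ny ry ey]; split; first exact: belowD.
    by rewrite dTD; apply: rcycleD.
  by rewrite coefD rmorphD ex ey addr0.
- move=> a x [nx rx ex]; split; [exact: belowZ| |exact: ecoefZ].
  by rewrite shift_scaleE dZ; apply: rcycleZ.
- move=> m x [nx rx ex]; split; [exact: gr_below| |exact: ecoefG].
  by rewrite [gmg _ _ _]/(gr g _ x) sf_dgr; apply: rcycleG.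
Defined.

(* The conditions under which f extends one step further. *)
Definition liftable i (f : gmod_hom (P i) (L i)) : Prop :=
  [/\ exists n, forall x, below n (f x),
      forall x, d (f (dP i x)) = 0 /\ eps (coef (f (dP i x)) 0) = 0
    & match i return gmod_hom (P i) (L i) -> Prop with
      | 0 => fun f => forall x, d (f x) = 0 /\ eps (coef (f x) 0) = eP x
      | _.+1 => fun f => forall x, eps (coef (f x) 0) = 0
      end f].

Lemma liftable0 : exists f, @liftable 0 f.
Proof.
pose p := gmod_comp (layer_aug pi g0) (gincl (below_sub 0 1)).
have pE x : p x = eps (coef (gincl _ x : V) 0) by [].
have [|f fE] := P_proj (p := p) eP.
  move=> y; have [a <-] := pi_surj y.
  have aE : below_sub 0 1 (a *: ebas B 0 : V) by apply/belowZ/below_ebas.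
  by exists (gsub_mk aE); rewrite pE /= coefZ coef_ebas eqxx mulr1.
have f1 x : below 1 (gincl _ (f x) : V) := ginclP (f x).
have fe x : eps (coef (gincl _ (f x) : V) 0) = eP x by rewrite -pE fE.
exists (gmod_comp (gincl _) f); split=> [|x|x].
- by exists 1%N.
- split; first exact: (d_below1 (f1 _)).
  by rewrite [LHS]fe; apply/exact0; exists x.
- by split; [apply: (d_below1 (f1 _))|apply: fe].
Qed.

Lemma liftableS i (f : gmod_hom (P i) (L i)) : liftable f ->
  exists f' : gmod_hom (P i.+1) (L i.+1), liftable f' /\ forall x, d (f' x) = f (dP i x).
Proof.
move=> [[n fn] fd _]; have [n' kn] := kill n.
pose S := rcycle_sub i n; pose S' := rbound_sub i.+1 n (maxn n' 1).
have pS (x : gsubmod S') : S (gmod_comp (layer_d T i) (gincl S') x).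
  by case: (ginclP x).
pose p := gcorestr pS.
have fS (x : P i.+1) : S (gmod_comp f (dP i) x).
  by have [df ef] := fd x; split=> //; apply: fn.
have [|l lE] := P_proj (p := p) (gcorestr fS).
  move=> x; have [nx dx ex] := ginclP x.
  have [y ny dy] := kn _ (And3 nx dx ex).
  have [c cy] := pi_surj (eps (coef y 0)).
  have yE : S' (y - (c : B) *: ebas B 0 : V).
    split.
    - apply: belowB; first by apply: below_le ny; apply: leq_maxl.
      by apply/belowZ/(below_le _ (@below_ebas B 0)); apply: leq_maxr.
    - by rewrite dTB dZ dT_ebas b0 scaler0 subr0 dy.
    - by rewrite coefB coefZ coef_ebas eqxx mulr1 rmorphB /= [pi c]cy subrr.
  exists (gsub_mk yE); apply: gincl_inj; rewrite gcorestrE /=.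
  by rewrite dTB dZ dT_ebas b0 scaler0 subr0 dy.
have dl x : d (gincl _ (l x) : V) = f (dP i x).
  by have := congr1 (gincl S) (lE x); rewrite !gcorestrE.
exists (gmod_comp (gincl _) l); split; last exact: dl.
have lP x := ginclP (l x); split=> [|x|x].
- by exists (maxn n' 1) => x; case: (lP x).
- split; last by case: (lP (dP i.+1 x)).
  rewrite [LHS]dl; have -> : dP i (dP i.+1 x) = 0 by apply/exactS; exists x.
  exact: (gh0 f).
- by case: (lP x).
Qed.

Let dPdP n x : dP n (dP n.+1 x) = 0.
Proof. by apply/exactS; exists x. Qed.

Lemma projdim_sf_bounded : sf_bounded T.
Proof.
have [f fP] := dep_seq_choice liftable0 liftableS.
pose X := tot dPdP P_fin.
pose F (x : X) : V := \sum_(i < N.+1) (f i (tot_coef x i) : V).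
have FD (x y : X) : F (x + y) = F x + F y.
  by rewrite /F -big_split; apply: eq_bigr => i _; apply: (ghD (f i)).
have FZ (a : B) (x : X) : F (a *: x) = a *: F x.
  rewrite /F scaler_sumr; apply: eq_bigr => i _.
  by rewrite tot_coefZ (ghZ (f i)) shift_scaleE tsgnN tsgnK.
have FG r (x : X) : homog (gmg X) r x -> homog (gmg (sfmod T)) r (F x).
  move=> /tot_homogP hx; apply: homog_sum => i _.
  have := gmod_hom_homog (f i) (hx i).
  by rewrite {1}/homog /= /shift_gpr opprK subrK.
have f0E (x : P 0%N) : d (f 0%N x) = 0 /\ eps (coef (f 0%N x) 0) = eP x.
  by have [[_ _ h] _] := fP 0%N; apply: h.
have fSE i (x : P i.+1) : eps (coef (f i.+1 x) 0) = 0.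
  by have [[_ _ h] _] := fP i.+1; apply: h.
have Fd (x : X) : F (dgmd X x) = dgmd (sfmod T) (F x).
  rewrite /F diff_sum big_ord_recr [RHS]big_ord_recl /=.
  rewrite (f0E _).1 add0r tot_coef_mk (_ : tot_coef x N.+1 = 0); last exact: P_fin.
  rewrite !gh0 addr0; apply: eq_bigr => i _; rewrite tot_coef_mk.
  by have [_ <-] := fP i.
pose Fh := @build_dgmod_hom B X (sfmod T) F FD FZ FG Fd.
have Fe (x : X) : eps (coef (F x) 0) = eP (tot_coef x 0).
  rewrite /F big_ord_recl coefD rmorphD (f0E _).2 coef_sum rmorph_sum big1 ?addr0 // => i _.
  exact: fSE.
have Fq : dgmod_quasi_iso Fh.
  split=> [x dx [y Fx]|y dy].
    have ex : eP (tot_coef x 0) = 0.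
      by rewrite -Fe [F x]Fx; apply: eps_dT.
    have dxn n : dP n (tot_coef x n.+1) = 0.
      by rewrite -[LHS](tot_coef_mk P_fin (fun n => dP n (tot_coef x n.+1))) [X in tot_coef X]dx.
    have Y n : exists y, dP n y = tot_coef x n.
      case: n => [|n]; first by have [y' ->] := (exact0 _).1 ex; exists y'.
      by have [y' ->] := (exactS _).1 (dxn n); exists y'.
    pose z := tot_mk P_fin (fun n => match n return P n with
      | 0 => 0 | m.+1 => sval (cid (Y m)) end).
    exists z; apply: tot_ext => n; rewrite tot_coef_mk.
    by rewrite tot_coef_mk (svalP (cid (Y n))).
  have [x0 ex0] := eP_surj (eps (coef y 0)).
  pose x := tot_mk P_fin (fun n => match n return P n with 0 => x0 | m.+1 => 0 end).
  have Fx : F x = f 0%N x0.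
    by rewrite /F big_ord_recl big1 ?addr0 // => i _; rewrite tot_coef_mk gh0.
  have [n ny] := below_ex (y - F x); have [n' kn] := kill n.
  have [|z _ dz] := kn (y - F x).
    split=> //; first by rewrite dTB [d y]dy Fx (f0E _).1 subrr.
    by rewrite coefB rmorphB Fx (f0E _).2 [X in _ - X]ex0 subrr.
  exists x; split.
    by apply: tot_ext => i; rewrite tot_coef_mk tot_coef_mk gh0.
  by exists z; rewrite sfdE dz addrC subrK.
have [l lF] := sf_lift Fq (dgmod_idhom (sfmod T)).
have fb i : exists n, forall x, below n (f i x) by have [[]] := fP i.
pose n := \max_(i < N.+1) sval (cid (fb i)).
have lb x : below n (F (l x)).
  apply: below_sum => i _; apply: below_le (svalP (cid (fb i)) _).
  exact: (leq_bigmax (F := fun i : 'I_N.+1 => sval (cid (fb i)))).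
exact: (retract_bounded (homotopic_sym lF) lb).
Qed.

End ProjdimBounded.

Lemma homology_graded_commutative (A : dga) :
  graded_commutative A -> graded_commutative (homology_gring A).
Proof.
move=> Ac m n _ _ /homog_hrepr[x hx ->] /homog_hrepr[y hy ->].
have -> : ksign (homology_gring A) (m * n) = hclass (ksign (cycles A) (m * n)).
  rewrite /ksign; elim: (absz (m * n)) => [|l IH]; first by rewrite !expr0.
  rewrite !exprS IH -[RHS]hclassM; congr (_ * _).
  by rewrite /hclass raddfN.
rewrite -[LHS]/(hmul _ _) -[RHS]/(hmul _ (hmul _ _)) !hclassM; congr hclass.
apply: val_inj; rewrite !cvalM (Ac _ _ _ _ hx hy); congr (_ * _).
by rewrite /ksign [RHS]rmorphXn rmorphN1.
Qed.

Lemma regular_zero_diff (R k : gring) (pi : gring_hom R k) :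
  graded_commutative R -> graded_noetherian R -> (forall y, exists x, pi x = y) ->
  (homotopically_regular (dga_hom_of_gring pi) <-> finite_projdim (gmod_of_hom pi)).
Proof.
move=> Rc Rn ps; pose eps := dga_hom_of_gring pi.
have se : surj_homology eps by move=> y; have [x <-] := ps y; exists x.
have [T [w [[g0 b0] w0 eb kill wb]]] := sf_resolution_ex eps (noetherian_zero_diff Rc Rn).
have qq := sf_aug_qis g0 eb se b0 kill.
have {}wb : weighted (sfb T) w by apply: wb.
split=> [/(compact_bounded qq)|[P [d [e [N [P_proj e_surj e0 eS P_fin]]]]]].
  exact: (sf_bounded_projdim g0 w0 eb kill wb ps).
apply: (bounded_compact qq).
exact: (projdim_sf_bounded g0 b0 eb kill ps P_proj e_surj e0 eS P_fin).
Qed.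

Theorem mainTheorem10 (A : dga) (k : gring)
    (pi : gring_hom (homology_gring A) k)
    (eps : dga_hom A (dga_of_gring k)) :
  graded_commutative A ->
  graded_local (homology_gring A) ->
  graded_noetherian (homology_gring A) ->
  residue_map pi ->
  formal_augmented eps pi ->
  (homotopically_regular eps <-> algebraically_regular pi).
Proof.
move=> Ac _ Hn [ps _] /zigzag_compact[gXY cXY].
have Hc := homology_graded_commutative Ac.
apply: iff_trans (regular_zero_diff Hc Hn ps); apply/cXY/gXY; split.
  exact: noetherian_zero_diff.
by move=> y; have [x <-] := ps y; exists x.
Qed.
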